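(* Let $1\le p<2$ and let $\{X_{m,n},\, m\ge 1,\, n\ge 1\}$ be a double array of random variables satisfying Condition $(H_2)$. (Sufficiency) If $\{X_{m,n},\, m\ge 1,\, n\ge 1\}$ is stochastically dominated by a random variable $X$ satisfying $$\mathbb{E}|X|^p<\infty, \qquad (1)$$ then $$\frac{\max_{1\le u\le m,\,1\le v\le n}\left|\sum_{i=1}^{u}\sum_{j=1}^{v}(X_{i,j}-\mathbb{E}X_{i,j})\right|}{(mn)^{1/p}}\to 0\ \text{ in }\mathcal{L}_p\text{ as }\ m\vee n\to\infty.$$ (Necessity) Conversely, if the random variables $X_{m,n}$, $m\ge1$, $n\ge1$, all have the same distribution function as a random variable $X$ and, for some real number $\mu$, $$\frac{\max_{1\le u\le m,\,1\le v\le n}\left|\sum_{i=1}^{u}\sum_{j=1}^{v}(X_{i,j}-\mu)\right|}{(mn)^{1/p}}\to 0\ \text{ in }\mathcal{L}_p\text{ as }\ m\vee n\to\infty,$$ then $\mathbb{E}X=\mu$ and (1) holds.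
   Context: Notation: $m\vee n=\max\{m,n\}$, and limits as $m\vee n\to\infty$ are over pairs $(m,n)$ of positive integers with $\max\{m,n\}\to\infty$. Convergence of $Y_{m,n}$ to $0$ in $\mathcal{L}_p$ means $\mathbb{E}|Y_{m,n}|^p\to0$. Condition $(H_2)$: a family of random variables $\{X_\lambda,\lambda\in\Lambda\}$ (on a common probability space) satisfies Condition $(H_2)$ if there is a finite absolute constant $C$ (not depending on $I$ or on the functions $f_\lambda$) such that for every finite subset $I\subset\Lambda$ and every family of increasing (i.e. nondecreasing) functions $f_\lambda:\mathbb{R}\to\mathbb{R}$, $\lambda\in I$, $$\mathbb{E}\left|\sum_{\lambda\in I}\left(f_\lambda(X_\lambda)-\mathbb{E}f_\lambda(X_\lambda)\right)\right|^{2}\le C\left(|I|\max_{\lambda\in I}\mathbb{E}|f_\lambda(X_\lambda)|^{2}+|I|\max_{\lambda\in I}\mathbb{E}f_\lambda^2(X_\lambda)\right),$$ provided the expectations are finite. Here $|I|$ is the cardinality of $I$. Stochastic domination: a family $\{X_\lambda,\lambda\in\Lambda\}$ is stochastically dominated by a random variable $X$ if $\sup_{\lambda\in\Lambda}\mathbb{P}(|X_\lambda|>x)\le\mathbb{P}(|X|>x)$ for all $x\in\mathbb{R}$. *)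

(* Defs.v *)
From HB Require Import structures.
From mathcomp Require Import all_boot all_order all_algebra.
From mathcomp Require Import finmap.
From mathcomp Require Import all_classical all_reals all_analysis.

Set Implicit Arguments.
Unset Strict Implicit.
Unset Printing Implicit Defensive.

Import Order.TTheory GRing.Theory Num.Theory.
Import numFieldNormedType.Exports.

Local Open Scope classical_set_scope.
Local Open Scope ring_scope.

Definition posidx : set (nat * nat) :=
  [set mn | (0 < mn.1)%N /\ (0 < mn.2)%N].

(* The limit "m \/ n -> oo" along pairs of positive integers: it is the maximum
   that tends to infinity, so one of the two indices may stay bounded. *)
Definition maxn_oo : set_system (nat * nat) :=
  filter_from [set: nat]
    (fun N => [set mn | posidx mn /\ (N <= maxn mn.1 mn.2)%N]).

Global Instance maxn_oo_filter : ProperFilter maxn_oo.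
Proof.
apply: filter_from_proper; last first.
  move=> N _; exists (N.+1, N.+1); split; first by split.
  by rewrite /= maxnn leqnSn.
apply: filter_from_filter; first by exists 0%N.
move=> M N _ _; exists (maxn M N) => // mn [mn0].
by rewrite geq_max => /andP[HM HN]; do 2?split.
Qed.

(* Families are functions on a choiceType K, of which only the members indexed
   by L are relevant. *)
Section families.
Context {d : measure_display} {T : measurableType d} {R : realType}
  {P : probability T R} {K : choiceType}.

(* The two terms on the right-hand side are the p = 2 instances of the terms
   |I| max E|f|^p and (|I| max E f^2)^(p/2) of the general condition; the empty
   maximum is 0. *)
Definition condition_H2 (L : set K) (X : K -> {RV P >-> R}) : Prop :=
  exists C : R, forall (I : {fset K}) (f : K -> R -> R),
    [set` I] `<=` L ->
    (forall k, k \in I -> {homo f k : x y / x <= y}) ->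
    (forall k, k \in I ->
       P.-integrable [set: T] (fun w => (f k (X k w))%:E)) ->
    (forall k, k \in I -> 'E_P[fun w => (`|f k (X k w)| ^+ 2)%R] < +oo)%E ->
    ('E_P[fun w => (`|\sum_(k <- I)
        (f k (X k w) - fine ('E_P[fun w' => f k (X k w')])%E)| ^+ 2)%R]
     <= C%:E *
        (#|` I|%:R%:E * \big[maxe/0]_(k <- I) 'E_P[fun w => (`|f k (X k w)| ^+ 2)%R]
         + #|` I|%:R%:E * \big[maxe/0]_(k <- I) 'E_P[fun w => (f k (X k w) ^+ 2)%R]))%E.

(* The dominating variable may live on another probability space. *)
Definition stochastically_dominated (L : set K) (X : K -> {RV P >-> R})
    {d' : measure_display} {T' : measurableType d'} {P' : probability T' R}
    (Y : {RV P' >-> R}) : Prop :=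
  forall x : R,
    (ereal_sup [set P [set w | (x < `|X k w|)%R] | k in L]
     <= P' [set w | (x < `|Y w|)%R])%E.

Definition cvg_Lp_to0 (F : set_system K) (p : R) (Y : K -> T -> R) : Prop :=
  'E_P[fun w => (`|Y k w| `^ p)%R]%E @[k --> F] --> 0%E.

End families.

Arguments cvg_Lp_to0 {d T R} P {K} F p Y.

(* max_(1 <= u <= m, 1 <= v <= n) |sum_(i <= u) sum_(j <= v) (X_ij - c_ij)|
   divided by (mn)^(1/p); all the terms are nonnegative, so the default value
   0 of the maximum is harmless. *)
Definition normalized_max {T : Type} {R : realType} (p : R)
    (X : nat * nat -> T -> R) (c : nat * nat -> R) (mn : nat * nat) (w : T) : R :=
  (\big[Num.max/0]_(1 <= u < mn.1.+1) \big[Num.max/0]_(1 <= v < mn.2.+1)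
     `|\sum_(1 <= i < u.+1) \sum_(1 <= j < v.+1) (X (i, j) w - c (i, j))|)
  / (mn.1 * mn.2)%:R `^ p^-1.

(* Main.v *)
From HB Require Import structures.
Require Import Defs.
From mathcomp Require Import all_boot all_order all_algebra.
From mathcomp Require Import finmap ring lra.
From mathcomp Require Import all_classical all_reals all_analysis measurable_realfun.

Set Implicit Arguments.
Unset Strict Implicit.
Unset Printing Implicit Defensive.

Import Order.TTheory GRing.Theory Num.Theory.
Import numFieldNormedType.Exports.

Local Open Scope classical_set_scope.
Local Open Scope ring_scope.

(** The only probabilistic input is a variance bound: the centred sum of
    [f (X_k)] over a finite block, [f] nondecreasing, has second moment at most
    a constant times the size of the block times [max E f(X_k)^2].  Truncations
    at a level and the corresponding excesses are nondecreasing functions, so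
    the bound applies to every truncated array.  Writing [X] as the difference
    of its positive and negative parts reduces sufficiency to nonnegative
    arrays [Z] dominated by a variable [Y >= 0] with [E Y^p < oo].

    Two difficulties remain.  The first is the maximum over all subrectangles.
    Dyadic chaining at one fixed truncation level would lose logarithmic
    factors.  They disappear when the level decreases together with the scale:
    a rectangle with [2^s] cells is truncated at [2^(s/p)].  Halving a rectangle
    replaces the maximum by the larger of two maxima, plus a term for one half
    (its sum, or a maximum in the other direction only), plus the change of
    level in both halves.  The change of level is a
    nonnegative array, whose uncentred partial sums are monotone in the
    rectangle; its maximal fluctuation is therefore governed by a single sum
    and by its total mean.  This gives a linear recurrence for the second
    moments ([rect_chaining], built on [row_chaining] for maxima in one
    direction), of ratio about [2] against the normalization [2^(2s/p)].  As
    [p < 2] this ratio is a contraction, and the inhomogeneous terms tend to [0]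
    by dominated convergence.

    The second difficulty is the excess over the top level: it has a [p]-th
    moment but possibly no second moment, whereas the hypothesis speaks of
    second moments only.  Cutting at an arbitrary height [t] shows that
    [E min(W^2, t |W|)] for a block sum [W] is at most a constant times the
    number of terms times the same quantity for one term ([block_kfun]).  For
    [1 < p < 2] the function [x^p] is comparable to the sum of
    [t^(p-2) min(x^2, t x)] over dyadic [t], so that the inequality passes to
    [p]-th moments ([block_pth_moment]); for [p = 1] the triangle inequality is
    enough.  The [p]-th moment of the excess is then of the order of the number
    of terms times [E (Y^p; Y > level)], which is negligible.  Both parts meet
    in [dominated_rectmax_moment]; rounding the sides of a rectangle up to
    powers of two yields [sufficiency].

    For necessity, the first cell alone bounds [|X_11 - mu|] by the maximum, so
    convergence in [L_p] forces [E |Y|^p < oo]; the variables having the law of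
    [Y], sufficiency then applies with the true mean as centring.  The two
    centrings differ by [mn |mu - E Y|] over the whole rectangle, which
    dominates the normalization [(mn)^(1/p)] because [p >= 1]; both normalized
    maxima being small, [mu = E Y]. *)

(** * Expectations of nonnegative functions *)

Section expectation_toolbox.
Context {d : measure_display} {T : measurableType d} {R : realType}.
Context {P : probability T R}.
Implicit Types f g h : T -> R.

(** The integral of a nonnegative function is the supremum over the simple
    functions below it, whence monotonicity for arbitrary functions. *)
Lemma expectation_mono f g :
  (forall w, 0 <= f w) -> (forall w, f w <= g w) -> ('E_P[f] <= 'E_P[g])%E.
Proof.
move=> f0 fg; rewrite unlock !ge0_integralTE => [||w]; last 2 first.
- by move=> w; rewrite lee_fin (le_trans (f0 w)).
- by rewrite lee_fin.
apply: le_ereal_sup => _ [s /= sf <-]; exists s => //= w.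
by rewrite (le_trans (sf w))// lee_fin.
Qed.

(** The workhorse for moment estimates: a pointwise bound by a linear
    combination becomes a bound between real numbers, which also records that
    the moment is finite. *)
Lemma expectation_comb (a b A B : R) f g h :
  0 <= a -> 0 <= b ->
  measurable_fun setT g -> measurable_fun setT h ->
  (forall w, 0 <= f w) -> (forall w, 0 <= g w) -> (forall w, 0 <= h w) ->
  (forall w, f w <= a * g w + b * h w) ->
  ('E_P[g] <= A%:E)%E -> ('E_P[h] <= B%:E)%E ->
  ('E_P[f] <= (a * A + b * B)%:E)%E.
Proof.
move=> a0 b0 mg mh f0 g0 h0 fgh gA hB.
apply: le_trans
  (@expectation_mono f (fun w => a * g w + b * h w) f0 fgh) _.
have mscale (c : R) (k : T -> R) : measurable_fun setT k ->
    measurable_fun setT (fun w => c * k w).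
  by move=> mk; exact: measurable_funM.
rewrite unlock; under eq_integral do rewrite EFinD.
rewrite ge0_integralD//=; first last.
- by apply/measurable_EFinP; exact: mscale.
- by move=> w _; rewrite lee_fin mulr_ge0.
- by apply/measurable_EFinP; exact: mscale.
- by move=> w _; rewrite lee_fin mulr_ge0.
under eq_integral do rewrite EFinM.
under [X in (_ + X)%E]eq_integral do rewrite EFinM.
rewrite !ge0_integralZl_EFin//=; first last.
- exact/measurable_EFinP.
- by move=> w _; rewrite lee_fin.
- exact/measurable_EFinP.
- by move=> w _; rewrite lee_fin.
move: gA hB; rewrite unlock => gA hB.
by rewrite EFinD leeD// EFinM lee_wpmul2l// lee_fin.
Qed.

Lemma expectation_const (c : R) : 'E_P[fun=> c]%E = c%:E.
Proof. exact: expectation_cst. Qed.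

Lemma expectation_scale (a A : R) f g :
  0 <= a -> measurable_fun setT g ->
  (forall w, 0 <= f w) -> (forall w, 0 <= g w) ->
  (forall w, f w <= a * g w) -> ('E_P[g] <= A%:E)%E ->
  ('E_P[f] <= (a * A)%:E)%E.
Proof.
move=> a0 mg f0 g0 fg gA.
rewrite -[a * A]addr0 -[0](mulr0 0).
apply: (expectation_comb (g := g) (h := fun=> 0)) => //.
- by move=> w; rewrite mulr0 addr0.
- by rewrite expectation_const.
Qed.

Lemma integrable_of_expectation (A : R) f :
  measurable_fun setT f -> (forall w, 0 <= f w) -> ('E_P[f] <= A%:E)%E ->
  P.-integrable setT (EFin \o f).
Proof.
move=> mf f0; rewrite unlock => fA; apply/integrableP; split.
  exact/measurable_EFinP.
under eq_integral do rewrite /= ger0_norm//.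
by rewrite (le_lt_trans fA) ?ltry.
Qed.

Lemma fine_expectation_bounds (A : R) f :
  (forall w, 0 <= f w) -> ('E_P[f] <= A%:E)%E ->
  [/\ 0 <= fine 'E_P[f]%E, fine 'E_P[f]%E <= A & 'E_P[f]%E = (fine 'E_P[f]%E)%:E].
Proof.
move=> f0 fA; have E0 := expectation_ge0 P f0.
have Efin : ('E_P[f])%E \is a fin_num.
  by rewrite ge0_fin_numE// (le_lt_trans fA) ?ltry.
by split; rewrite ?fineK// ?fine_ge0// -lee_fin fineK.
Qed.

End expectation_toolbox.

(** * Comparison of tails *)

Section tail_domination.
Context {R : realType} {d d' : measure_display} {T : measurableType d}
  {T' : measurableType d'} {P : probability T R} {P' : probability T' R}.

(** Tails speak of open half-lines.  A superlevel set of a nondecreasing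
    function is a half-line, and continuity makes it open. *)
Lemma superlevel_ray (g : R -> R) (r x0 u0 : R) :
  {homo g : x y / x <= y} -> continuous g -> g x0 <= r -> r < g u0 ->
  exists c, forall x, (r < g x) = (c < x).
Proof.
move=> gnd gc gx0 gu0.
have lbU : lbound [set x | r < g x] x0.
  move=> x /= rx; rewrite leNgt; apply/negP => xx0.
  by move: (le_lt_trans (gnd _ _ (ltW xx0)) (le_lt_trans gx0 rx)); rewrite ltxx.
have hinf : has_inf [set x | r < g x] by split; [exists u0|exists x0].
exists (inf [set x | r < g x]) => x; apply/idP/idP => [rx|].
  have /nbhs_ballP[e /= e0 xe] : \forall y \near x, r < g y.
    exact: (cvgr_gt (g x) (gc x)) rx.
  have : r < g (x - e / 2).
    apply: xe; rewrite /ball /= opprD addrA subrr add0r opprK ger0_norm.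
      by rewrite ltr_pdivrMr// ltr_pMr// ltr1n.
    by rewrite divr_ge0// ltW.
  move=> /(ge_inf (ex_intro _ _ lbU)) /le_lt_trans; apply.
  by rewrite ltrBlDr ltrDl divr_gt0.
move=> infx; have epsP : 0 < x - inf [set x | r < g x] by rewrite subr_gt0.
have [u /= ru ux] := inf_adherent epsP hinf.
by apply: lt_le_trans ru (gnd _ _ _); move: ux; rewrite addrC subrK => /ltW.
Qed.

(** Layer-cake formula: the expectation of [g X] integrates the
    probabilities of the superlevel sets of [g], and these are events [c < X]. *)
Lemma expectation_le_of_tails (X : T -> R) (Y : T' -> R) (g : R -> R) :
  measurable_fun setT X -> measurable_fun setT Y ->
  (forall w, 0 <= Y w) ->
  (forall x : R, P [set w | (x < X w)%R] <= P' [set w | (x < Y w)%R])%E ->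
  {homo g : x y / x <= y} -> continuous g -> (forall x, 0 <= g x) ->
  ('E_P[fun w => g (X w)] <= 'E_P'[fun w => g (Y w)])%E.
Proof.
move=> mX mY Y0 XY gnd gc g0.
have mg : measurable_fun setT g by exact: continuous_measurable_fun.
have mgX : measurable_fun setT (g \o X) by exact: measurableT_comp.
have mgY : measurable_fun setT (g \o Y) by exact: measurableT_comp.
pose gX : {RV P >-> R} :=
  HB.pack (g \o X) (isMeasurableFun.Build _ _ _ _ (g \o X) mgX).
pose gY : {RV P' >-> R} :=
  HB.pack (g \o Y) (isMeasurableFun.Build _ _ _ _ (g \o Y) mgY).
rewrite (ge0_expectation_ccdf (X := gX)) => [|w]; last exact: g0.
rewrite (ge0_expectation_ccdf (X := gY)) => [|w]; last exact: g0.
apply: ge0_le_integral => //=.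
- by apply: measurable_funS (ccdf_measurable _).
- by apply: measurable_funS (ccdf_measurable _).
move=> r _.
have ccdfE d1 (T1 : measurableType d1) (Q : probability T1 R) (Z : {RV Q >-> R}) :
    ccdf Z r = Q [set w | r < Z w].
  rewrite /ccdf /distribution /pushforward /=; congr (Q _).
  by apply/seteqP; split=> w /=; rewrite in_itv/= andbT.
rewrite !ccdfE /=.
have [[u0 gu0]|] := pselect (exists u, r < g u); last first.
  move=> nu; rewrite (_ : [set w | _] = set0) ?measure0//.
  by apply/seteqP; split=> w //= rw; apply: nu; exists (X w).
have [[x0 [_ gx0]]|nx] := pselect (exists x, 0 <= x /\ g x <= r).
  have [c cE] := superlevel_ray gnd gc gx0 gu0.
  rewrite (_ : [set w | r < g (X w)] = [set w | c < X w]); last first.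
    by apply/seteqP; split=> w /=; rewrite cE.
  rewrite (_ : [set w | r < g (Y w)] = [set w | c < Y w])//.
  by apply/seteqP; split=> w /=; rewrite cE.
rewrite (_ : [set w | r < g (Y w)] = setT) ?probability_setT.
  apply: probability_le1; rewrite -[X in measurable X]setTI.
  exact: measurable_fun_ltr.
apply/seteqP; split=> w //= _; rewrite ltNge; apply/negP => gY0.
by apply: nx; exists (Y w).
Qed.

End tail_domination.

(** * Maximal partial sums over rectangles *)

Section rectangle_sums.
Context {R : realType}.
Implicit Types (z y e : nat -> nat -> R) (a b m n u v : nat).

Definition rsum z a b m n : R := \sum_(i < m) \sum_(j < n) z (a + i)%N (b + j)%N.

(** Splitting a rectangle into two stacked halves leaves, over the first half,
    a maximum in which only the number of columns varies; hence this
    one-directional maximum. *)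
Definition rowmax z a b m n : R :=
  \big[Num.max/0]_(v < n.+1) `|rsum z a b m v|.

Definition rectmax z a b m n : R :=
  \big[Num.max/0]_(u < m.+1) rowmax z a b u n.

Lemma rsum_rows z a b m1 m2 n :
  rsum z a b (m1 + m2) n = rsum z a b m1 n + rsum z (a + m1) b m2 n.
Proof.
rewrite /rsum big_split_ord/=; congr (_ + _); apply: eq_bigr => i _.
by apply: eq_bigr => j _; rewrite addnA.
Qed.

Lemma rsum_cols z a b m n1 n2 :
  rsum z a b m (n1 + n2) = rsum z a b m n1 + rsum z a (b + n1) m n2.
Proof.
rewrite /rsum -big_split/=; apply: eq_bigr => i _.
rewrite big_split_ord/=; congr (_ + _).
by apply: eq_bigr => j _; rewrite addnA.
Qed.

Lemma rsumD z1 z2 a b m n :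
  rsum (fun i j => z1 i j + z2 i j) a b m n = rsum z1 a b m n + rsum z2 a b m n.
Proof.
by rewrite /rsum -big_split/=; apply: eq_bigr => i _; rewrite big_split.
Qed.

Lemma rsumB z1 z2 a b m n :
  rsum (fun i j => z1 i j - z2 i j) a b m n = rsum z1 a b m n - rsum z2 a b m n.
Proof.
by rewrite /rsum -sumrB/=; apply: eq_bigr => i _; rewrite sumrB.
Qed.

Lemma rsum_cst (c : R) a b m n : rsum (fun _ _ => c) a b m n = (m * n)%:R * c.
Proof.
rewrite /rsum; under eq_bigr do rewrite sumr_const card_ord.
by rewrite sumr_const card_ord -mulrnA mulnC mulr_natl.
Qed.

Lemma ler_rsum z1 z2 a b m n :
  (forall i j, z1 i j <= z2 i j) -> rsum z1 a b m n <= rsum z2 a b m n.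
Proof. by move=> z12; apply: ler_sum => i _; apply: ler_sum => j _. Qed.

Lemma rsum_ge0 z a b m n : (forall i j, 0 <= z i j) -> 0 <= rsum z a b m n.
Proof. by move=> z0; apply: sumr_ge0 => i _; apply: sumr_ge0 => j _. Qed.

Lemma ler_rsum_dim z a b u v m n : (forall i j, 0 <= z i j) ->
  (u <= m)%N -> (v <= n)%N -> rsum z a b u v <= rsum z a b m n.
Proof.
move=> z0 /subnKC <- /subnKC <-; rewrite rsum_rows !rsum_cols.
by rewrite -addrA lerDl !addr_ge0// rsum_ge0.
Qed.

Lemma rowmax_ge z a b m n v : (v <= n)%N ->
  `|rsum z a b m v| <= rowmax z a b m n.
Proof.
rewrite -ltnS => vn.
exact: (le_bigmax 0 (fun i : 'I_n.+1 => `|rsum z a b m i|) (Ordinal vn)).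
Qed.

Lemma rowmax_le z a b m n x : 0 <= x ->
  (forall v, (v <= n)%N -> `|rsum z a b m v| <= x) -> rowmax z a b m n <= x.
Proof.
by move=> x0 zx; apply: bigmax_le => // i _; apply: zx; rewrite -ltnS.
Qed.

Lemma rowmax_ge0 z a b m n : 0 <= rowmax z a b m n.
Proof. by apply: le_trans (normr_ge0 _) (rowmax_ge _ _ _ _ (leq0n n)). Qed.

Lemma rectmax_ge_row z a b m n u : (u <= m)%N ->
  rowmax z a b u n <= rectmax z a b m n.
Proof.
rewrite -ltnS => um.
exact: (le_bigmax 0 (fun i : 'I_m.+1 => rowmax z a b i n) (Ordinal um)).
Qed.

Lemma rectmax_ge z a b m n u v : (u <= m)%N -> (v <= n)%N ->
  `|rsum z a b u v| <= rectmax z a b m n.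
Proof.
by move=> um vn; apply: le_trans (rowmax_ge _ _ _ _ vn) (rectmax_ge_row _ _ _ _ um).
Qed.

Lemma rectmax_ge0 z a b m n : 0 <= rectmax z a b m n.
Proof. exact: le_trans (normr_ge0 _) (rectmax_ge z a b (leq0n m) (leq0n n)). Qed.

Lemma rectmax_le z a b m n x : 0 <= x ->
  (forall u v, (u <= m)%N -> (v <= n)%N -> `|rsum z a b u v| <= x) ->
  rectmax z a b m n <= x.
Proof.
move=> x0 zx; apply: bigmax_le => // i _; apply: rowmax_le => // v vn.
by apply: zx => //; rewrite -ltnS.
Qed.

(** A partial sum that reaches into the second half is the whole first half
    plus a partial sum of the second. *)
Lemma rowmax_split z a b m n1 n2 :
  rowmax z a b m (n1 + n2) <=
  Num.max (rowmax z a b m n1) (rowmax z a (b + n1) m n2) + `|rsum z a b m n1|.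
Proof.
apply: rowmax_le => [|v vn]; first by rewrite addr_ge0// le_max rowmax_ge0.
have [vn1|/ltnW n1v] := leqP v n1.
  by rewrite ler_wpDr// le_max rowmax_ge.
rewrite -(subnKC n1v) rsum_cols addrC; apply: le_trans (ler_normD _ _) _.
by rewrite lerD2r le_max [X in _ || X]rowmax_ge ?orbT// leq_subLR.
Qed.

(** As for columns, except that the first half is cut at the same column as
    the partial sum, which brings in [rowmax]. *)
Lemma rectmax_split z a b m1 m2 n :
  rectmax z a b (m1 + m2) n <=
  Num.max (rectmax z a b m1 n) (rectmax z (a + m1) b m2 n) + rowmax z a b m1 n.
Proof.
apply: rectmax_le => [|u v um vn].
  by rewrite addr_ge0 ?rowmax_ge0// le_max rectmax_ge0.
have [um1|/ltnW m1u] := leqP u m1.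
  by rewrite ler_wpDr ?rowmax_ge0// le_max rectmax_ge.
rewrite -(subnKC m1u) rsum_rows addrC; apply: le_trans (ler_normD _ _) _.
by rewrite lerD ?rowmax_ge// le_max [X in _ || X]rectmax_ge ?orbT// leq_subLR.
Qed.

Lemma rowmaxD z1 z2 a b m n :
  rowmax (fun i j => z1 i j + z2 i j) a b m n <=
  rowmax z1 a b m n + rowmax z2 a b m n.
Proof.
apply: rowmax_le => [|v vn]; first by rewrite addr_ge0 ?rowmax_ge0.
by rewrite rsumD (le_trans (ler_normD _ _))// lerD ?rowmax_ge.
Qed.

Lemma rectmaxD z1 z2 a b m n :
  rectmax (fun i j => z1 i j + z2 i j) a b m n <=
  rectmax z1 a b m n + rectmax z2 a b m n.
Proof.
apply: rectmax_le => [|u v um vn]; first by rewrite addr_ge0 ?rectmax_ge0.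
by rewrite rsumD (le_trans (ler_normD _ _))// lerD ?rectmax_ge.
Qed.

(** Before centring, partial sums of nonnegative terms increase with the
    rectangle.  So all of them are controlled by the full rectangle, and
    centring costs at most the total mean: a maximum is bounded by one sum. *)
Lemma rectmax_centered y e (eb : R) a b m n :
  (forall i j, 0 <= y i j) -> (forall i j, 0 <= e i j <= eb) ->
  rectmax (fun i j => y i j - e i j) a b m n <=
  `|rsum (fun i j => y i j - e i j) a b m n| + (m * n)%:R * eb.
Proof.
move=> y0 eeb.
have e0 i j : 0 <= e i j by have /andP[] := eeb i j.
have emn : rsum e a b m n <= (m * n)%:R * eb.
  by rewrite -(rsum_cst eb a b); apply: ler_rsum => i j; have /andP[] := eeb i j.
have smn := rsum_ge0 a b m n e0.
apply: rectmax_le => [|u v um vn]; first by rewrite addr_ge0// (le_trans smn).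
have yuv := ler_rsum_dim a b y0 um vn; have euv := ler_rsum_dim a b e0 um vn.
have := rsum_ge0 a b u v y0; have := rsum_ge0 a b u v e0.
rewrite !rsumB => eu yu; have := ler_norm (rsum y a b m n - rsum e a b m n).
have := normr_ge0 (rsum y a b m n - rsum e a b m n).
by move=> N0 N; rewrite ler_norml; apply/andP; split; lra.
Qed.

End rectangle_sums.

(** * Truncation and measurability *)

Section truncation.
Context {R : realType}.
Implicit Types c x : R.

(** Clipping to the interval from [0] to [c].  Negative arguments occur in
    [trunc_layer], where the layer between two levels is a shifted clipping. *)
Definition trunc c x : R := Num.min (Num.max x 0) c.

Definition excess c x : R := Num.max (x - c) 0.

Lemma trunc_bounds c x : 0 <= c -> 0 <= trunc c x <= c.
Proof. by move=> c0; rewrite /trunc le_min ge_min c0 le_max !lexx !orbT. Qed.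

Lemma trunc_homo c : {homo trunc c : x y / x <= y}.
Proof.
by move=> x y xy; rewrite /trunc /Num.min /Num.max; repeat case: ifPn;
  rewrite -?leNgt => *; lra.
Qed.

Lemma excess_homo c : {homo excess c : x y / x <= y}.
Proof.
by move=> x y xy; rewrite /excess /Num.max; repeat case: ifPn;
  rewrite -?leNgt => *; lra.
Qed.

Lemma excess_ge0 c x : 0 <= excess c x.
Proof. by rewrite /excess le_max lexx orbT. Qed.

Lemma trunc_excess c x : 0 <= c -> 0 <= x -> x = trunc c x + excess c x.
Proof.
move=> c0 x0; rewrite /trunc /excess /Num.min /Num.max; repeat case: ifPn;
  rewrite -?leNgt => *; lra.
Qed.

(** The part of [x] lying between the levels [c] and [c'] is again a clipping,
    hence nonnegative, bounded and nondecreasing in [x]. *)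
Lemma trunc_layer c c' x : 0 <= c -> c <= c' ->
  trunc c' x = trunc c x + trunc (c' - c) (x - c).
Proof.
move=> c0 cc'; rewrite /trunc /Num.min /Num.max; repeat case: ifPn;
  rewrite -?leNgt => *; lra.
Qed.

Lemma trunc_layer_le c c' x : 0 <= c -> c <= c' ->
  trunc (c' - c) (x - c) <= trunc c' x.
Proof.
move=> c0 cc'; rewrite (trunc_layer x c0 cc') lerDr.
by have /andP[] := trunc_bounds x c0.
Qed.

Lemma trunc_le_excess c c' x : trunc c' (x - c) <= excess c x.
Proof. by rewrite /trunc /excess ge_min lexx. Qed.

Lemma trunc_continuous c : continuous (trunc c).
Proof.
move=> x; apply: (@continuous_min R R^o (fun y => Num.max y 0) (cst c) x).
  apply: (@continuous_max R R^o id (cst 0) x); [exact: cvg_id|exact: cvg_cst].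
exact: cvg_cst.
Qed.

Lemma excess_continuous c : continuous (excess c).
Proof.
move=> x; apply: (@continuous_max R R^o (fun y => y - c) (cst 0) x).
  by apply: cvgB; [exact: cvg_id|exact: cvg_cst].
exact: cvg_cst.
Qed.

End truncation.

Section measurability.
Context {d : measure_display} {T : measurableType d} {R : realType}.

Lemma measurable_bigmax (I : Type) (s : seq I) (F : I -> T -> R) :
  (forall i, measurable_fun setT (F i)) ->
  measurable_fun setT (fun w => \big[Num.max/0]_(i <- s) F i w).
Proof.
move=> mF; elim: s => [|i s IHs].
  under eq_fun do rewrite big_nil.
  exact: measurable_cst.
under eq_fun do rewrite big_cons.
exact: measurable_maxr.
Qed.

Variable z : T -> nat -> nat -> R.
Hypothesis mz : forall i j, measurable_fun setT (fun w => z w i j).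

Lemma measurable_rsum a b m n :
  measurable_fun setT (fun w => rsum (z w) a b m n).
Proof. by apply: measurable_sum => i; apply: measurable_sum => j. Qed.

Lemma measurable_rsum_norm a b m n :
  measurable_fun setT (fun w => `|rsum (z w) a b m n|).
Proof. by apply: measurableT_comp => //; exact: measurable_rsum. Qed.

Lemma measurable_rowmax a b m n :
  measurable_fun setT (fun w => rowmax (z w) a b m n).
Proof. by apply: measurable_bigmax => v; exact: measurable_rsum_norm. Qed.

Lemma measurable_rectmax a b m n :
  measurable_fun setT (fun w => rectmax (z w) a b m n).
Proof. by apply: measurable_bigmax => v; exact: measurable_rowmax. Qed.

End measurability.

(** * Chaining with a moving truncation level *)

Section max_step.
Context {d : measure_display} {T : measurableType d} {R : realType}.
Context {P : probability T R}.

(** The weight [th] stays free because the coefficient of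
    [x1 ^+ 2 + x2 ^+ 2] has to remain close to [1]: it is iterated once for each
    dyadic scale, whereas the cost of the other terms is a mere constant. *)
Lemma sqr_max_step (th x1 x2 y1 y2 y3 c u : R) :
  0 < th -> 0 <= x1 -> 0 <= x2 ->
  0 <= u <= Num.max x1 x2 + (y1 + y2 + y3 + c) ->
  u ^+ 2 <= (1 + th) * (x1 ^+ 2 + x2 ^+ 2) +
            4 * (1 + th^-1) * ((y1 ^+ 2 + y2 ^+ 2) + (y3 ^+ 2 + c ^+ 2)).
Proof.
move=> th0 x10 x20 /andP[u0 uxy].
set x := Num.max x1 x2 in uxy; set y := y1 + y2 + y3 + c in uxy.
have x2E : x ^+ 2 <= x1 ^+ 2 + x2 ^+ 2.
  by rewrite /x /Num.max; case: ifP => _; rewrite ?lerDl ?lerDr sqr_ge0.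
have yE : y ^+ 2 <= 4 * ((y1 ^+ 2 + y2 ^+ 2) + (y3 ^+ 2 + c ^+ 2)).
  rewrite -subr_ge0 /y.
  rewrite (_ : _ - _ = (y1 - y2) ^+ 2 + (y1 - y3) ^+ 2 + (y1 - c) ^+ 2 +
    (y2 - y3) ^+ 2 + (y2 - c) ^+ 2 + (y3 - c) ^+ 2); last by ring.
  by rewrite !addr_ge0// sqr_ge0.
have u2 : u ^+ 2 <= (x + y) ^+ 2 by rewrite ler_sqr ?nnegrE// (le_trans u0).
apply: (le_trans u2).
have th1 : 0 <= 1 + th by rewrite addr_ge0// ltW.
have th2 : 0 <= 1 + th^-1 by rewrite addr_ge0// invr_ge0 ltW.
apply: (@le_trans _ _ ((1 + th) * x ^+ 2 + (1 + th^-1) * y ^+ 2)).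
  rewrite -subr_ge0 (_ : _ - _ = th^-1 * (th * x - y) ^+ 2).
    by rewrite mulr_ge0 ?sqr_ge0// invr_ge0 ltW.
  by field; rewrite gt_eqF.
by rewrite lerD ?ler_wpM2l// [4 * _]mulrC -mulrA ler_wpM2l.
Qed.

Lemma expectation_add_le (A B : R) (g h : T -> R) :
  measurable_fun setT g -> measurable_fun setT h ->
  (forall w, 0 <= g w) -> (forall w, 0 <= h w) ->
  ('E_P[g] <= A%:E)%E -> ('E_P[h] <= B%:E)%E ->
  ('E_P[fun w => (g w + h w)%R] <= (A + B)%:E)%E.
Proof.
move=> mg mh g0 h0 gA hB; rewrite -[A]mul1r -[B]mul1r.
by apply: (expectation_comb (g := g) (h := h)) => // w; rewrite ?addr_ge0 ?mul1r.
Qed.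

(** One halving step at the level of second moments: [x1] and [x2] are the
    maxima over the two halves, [y1], [y2], [y3] the sums created by the step,
    and [c] bounds the means. *)
Lemma expectation_max_step (th A B c : R) (f x1 x2 y1 y2 y3 : T -> R) :
  0 < th ->
  measurable_fun setT x1 -> measurable_fun setT x2 ->
  measurable_fun setT y1 -> measurable_fun setT y2 -> measurable_fun setT y3 ->
  (forall w, 0 <= x1 w) -> (forall w, 0 <= x2 w) ->
  (forall w, 0 <= f w <= Num.max (x1 w) (x2 w) + (y1 w + y2 w + y3 w + c)) ->
  ('E_P[fun w => (x1 w ^+ 2)%R] <= A%:E)%E ->
  ('E_P[fun w => (x2 w ^+ 2)%R] <= A%:E)%E ->
  ('E_P[fun w => (y1 w ^+ 2)%R] <= B%:E)%E ->
  ('E_P[fun w => (y2 w ^+ 2)%R] <= B%:E)%E ->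
  ('E_P[fun w => (y3 w ^+ 2)%R] <= B%:E)%E ->
  ('E_P[fun w => (f w ^+ 2)%R] <=
    ((1 + th) * (2 * A) + 4 * (1 + th^-1) * (3 * B + c ^+ 2))%:E)%E.
Proof.
move=> th0 mx1 mx2 my1 my2 my3 x10 x20 fx E1 E2 B1 B2 B3.
have msq (k : T -> R) : measurable_fun setT k ->
    measurable_fun setT (fun w => k w ^+ 2).
  by move=> mk; exact: measurable_funX.
have sq0 (k : T -> R) w : 0 <= k w ^+ 2 by exact: sqr_ge0.
have -> : (1 + th) * (2 * A) + 4 * (1 + th^-1) * (3 * B + c ^+ 2) =
  (1 + th) * (A + A) + 4 * (1 + th^-1) * ((B + B) + (B + c ^+ 2)) by ring.
apply: (expectation_comb (g := fun w => x1 w ^+ 2 + x2 w ^+ 2)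
  (h := fun w => (y1 w ^+ 2 + y2 w ^+ 2) + (y3 w ^+ 2 + c ^+ 2))).
- by rewrite addr_ge0// ltW.
- by rewrite mulr_ge0// addr_ge0// invr_ge0 ltW.
- by apply: measurable_funD; exact: msq.
- apply: measurable_funD; first by apply: measurable_funD; exact: msq.
  by apply: measurable_funD => //; exact: msq.
- by move=> w; exact: sqr_ge0.
- by move=> w; rewrite addr_ge0.
- by move=> w; rewrite !addr_ge0// sqr_ge0.
- by move=> w; exact: sqr_max_step.
- by apply: expectation_add_le => //; exact: msq.
- apply: expectation_add_le => //.
  + by apply: measurable_funD; exact: msq.
  + by apply: measurable_funD => //; exact: msq.
  + by move=> w; rewrite addr_ge0.
  + by move=> w; rewrite addr_ge0// sqr_ge0.
  + by apply: expectation_add_le => //; exact: msq.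
  + apply: expectation_add_le => //; [exact: msq|by move=> w; exact: sqr_ge0|].
    by rewrite expectation_const.
Qed.

End max_step.

Section chaining.
Context {d : measure_display} {T : measurableType d} {R : realType}.
Context {P : probability T R}.
Variables (Z : nat -> nat -> T -> R) (K : R).
Hypothesis mZ : forall i j, measurable_fun setT (Z i j).
Hypothesis Z0 : forall i j w, 0 <= Z i j w.
Hypothesis K0 : 0 <= K.

Definition centered (f : R -> R) (w : T) (i j : nat) : R :=
  f (Z i j w) - fine 'E_P[fun w => f (Z i j w)]%E.

(** The form taken by the moment condition on a doubly indexed array; bounded
    functions make every centring finite. *)
Definition variance_bound : Prop :=
  forall (f : R -> R) (c B : R) (a b m n : nat),
    {homo f : x y / x <= y} -> (forall x, 0 <= f x <= c) ->
    (forall i j, 'E_P[fun w => (f (Z i j w) ^+ 2)%R] <= B%:E)%E ->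
    ('E_P[fun w => (rsum (centered f w) a b m n ^+ 2)%R] <=
      (K * (m * n)%:R * B)%:E)%E.

Hypothesis hvar : variance_bound.

Lemma measurable_comp_homo (f : R -> R) i j :
  {homo f : x y / x <= y} -> measurable_fun setT (fun w => f (Z i j w)).
Proof.
by move=> fnd; apply: measurableT_comp => //; exact: nondecreasing_measurable.
Qed.

Lemma measurable_centered (f : R -> R) i j :
  {homo f : x y / x <= y} -> measurable_fun setT (fun w => centered f w i j).
Proof.
by move=> fnd; apply: measurable_funB => //; exact: measurable_comp_homo.
Qed.

Lemma centeredD (f g h : R -> R) (A B : R) i j w :
  (forall x, 0 <= x -> f x = g x + h x) ->
  {homo g : x y / x <= y} -> {homo h : x y / x <= y} ->
  (forall x, 0 <= g x) -> (forall x, 0 <= h x) ->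
  ('E_P[fun w => g (Z i j w)] <= A%:E)%E ->
  ('E_P[fun w => h (Z i j w)] <= B%:E)%E ->
  centered f w i j = centered g w i j + centered h w i j.
Proof.
move=> fgh gnd hnd g0 h0 gA hB; rewrite /centered fgh//.
suff -> : 'E_P[fun w => f (Z i j w)]%E =
    ('E_P[fun w => g (Z i j w)] + 'E_P[fun w => h (Z i j w)])%E.
  have [_ _ ->] := fine_expectation_bounds (fun w => g0 (Z i j w)) gA.
  have [_ _ ->] := fine_expectation_bounds (fun w => h0 (Z i j w)) hB.
  by rewrite /=; ring.
rewrite (_ : (fun w => f _) = fun w => g (Z i j w) + h (Z i j w)); last first.
  by apply/funext => w'; rewrite fgh.
rewrite unlock; under eq_integral do rewrite EFinD.
rewrite ge0_integralD//=.
- by move=> w' _; rewrite lee_fin.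
- by apply/measurable_EFinP; exact: measurable_comp_homo.
- by move=> w' _; rewrite lee_fin.
- by apply/measurable_EFinP; exact: measurable_comp_homo.
Qed.

Lemma rectmax_centered_le (f : R -> R) (mu : R) w a b m n :
  (forall x, 0 <= f x) ->
  (forall i j, 'E_P[fun w => f (Z i j w)] <= mu%:E)%E ->
  rectmax (centered f w) a b m n <=
  `|rsum (centered f w) a b m n| + (m * n)%:R * mu.
Proof.
move=> f0 fmu; apply: (rectmax_centered (y := fun i j => f (Z i j w))) => // i j.
by have [-> ->] := fine_expectation_bounds (fun w => f0 (Z i j w)) (fmu i j).
Qed.

Section levels.
Variables (lvl m2 mu : nat -> R) (th : R).
Hypothesis lvl_gt0 : forall s, 0 < lvl s.
Hypothesis lvl_homo : forall s, lvl s <= lvl s.+1.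
Hypothesis th0 : 0 < th.
Hypothesis m2P : forall s i j,
  ('E_P[fun w => (trunc (lvl s) (Z i j w) ^+ 2)%R] <= (m2 s)%:E)%E.
Hypothesis muP : forall s i j,
  ('E_P[fun w => excess (lvl s) (Z i j w)] <= (mu s)%:E)%E.

(** The second moment of a block sum and the square of the total mean of a
    layer, for [2 ^ s] cells between the levels [s] and [s.+1]. *)
Definition step_error s : R :=
  K * (2 ^ s)%:R * m2 s.+1 + ((2 ^ s)%:R * mu s) ^+ 2.

(** The recurrences are indexed by [s] alone, [2 ^ s] being the number of
    cells, because the level depends on the shape of a rectangle only through
    its area. *)
Fixpoint row_bound s : R :=
  if s is s'.+1 then
    2 * (1 + th) * row_bound s' + 16 * (1 + th^-1) * step_error s'
  else K * m2 0.

Fixpoint rect_bound s : R :=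
  if s is s'.+1 then
    2 * (1 + th) * rect_bound s' +
    4 * (1 + th^-1) * (3 * row_bound s' + 12 * step_error s')
  else K * m2 0.

Let F s := trunc (lvl s).
Let G s (x : R) := trunc (lvl s.+1 - lvl s) (x - lvl s).

Let F_homo s : {homo F s : x y / x <= y}. Proof. exact: trunc_homo. Qed.

Let G_homo s : {homo G s : x y / x <= y}.
Proof. by move=> x y xy; apply: trunc_homo; rewrite lerD2r. Qed.

Let F_bounds s x : 0 <= F s x <= lvl s.
Proof. by apply: trunc_bounds; exact: ltW. Qed.

Let G_bounds s x : 0 <= G s x <= lvl s.+1 - lvl s.
Proof. by apply: trunc_bounds; rewrite subr_ge0. Qed.

Let F0 s x : 0 <= F s x. Proof. by have /andP[] := F_bounds s x. Qed.
Let G0 s x : 0 <= G s x. Proof. by have /andP[] := G_bounds s x. Qed.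

Let F_mean s i j : ('E_P[fun w => F s (Z i j w)] <= (lvl s)%:E)%E.
Proof.
rewrite -(expectation_const (P := P)); apply: expectation_mono => w //.
by have /andP[] := F_bounds s (Z i j w).
Qed.

Let G_mean s i j : ('E_P[fun w => G s (Z i j w)] <= (mu s)%:E)%E.
Proof.
by apply: le_trans (muP s i j); apply: expectation_mono => w //;
  exact: trunc_le_excess.
Qed.

Let centeredF s w i j :
  centered (F s.+1) w i j = centered (F s) w i j + centered (G s) w i j.
Proof.
apply: centeredD (F_mean s i j) (G_mean s i j) => // x _.
by apply: trunc_layer => //; exact: ltW.
Qed.

Let blockF s a b m n :
  ('E_P[fun w => (rsum (centered (F s) w) a b m n ^+ 2)%R] <=
    (K * (m * n)%:R * m2 s)%:E)%E.
Proof. exact: hvar (F_homo s) (F_bounds s) (m2P s). Qed.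

Let blockG s a b m n :
  ('E_P[fun w => (rsum (centered (G s) w) a b m n ^+ 2)%R] <=
    (K * (m * n)%:R * m2 s.+1)%:E)%E.
Proof.
apply: (hvar _ _ _ _ (G_homo s) (G_bounds s)) => i j.
apply: le_trans (m2P s.+1 i j); apply: expectation_mono => w.
  exact: sqr_ge0.
rewrite ler_sqr ?nnegrE; [|exact: G0|exact: F0].
exact: trunc_layer_le (ltW (lvl_gt0 s)) (lvl_homo s).
Qed.

Let m2_ge0 s : 0 <= m2 s.
Proof.
rewrite -lee_fin; apply: le_trans (m2P s 0 0); apply: expectation_ge0 => w.
exact: sqr_ge0.
Qed.

Let Km2_le s : K * (2 ^ s)%:R * m2 s.+1 <= step_error s.
Proof. by rewrite lerDl sqr_ge0. Qed.

Let mu2_le s : ((2 ^ s)%:R * mu s) ^+ 2 <= step_error s.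
Proof. by rewrite lerDr !mulr_ge0. Qed.

Lemma step_error_ge0 s : 0 <= step_error s.
Proof. by rewrite (le_trans _ (mu2_le s)) ?sqr_ge0. Qed.

Let thV0 : 0 <= th^-1. Proof. by rewrite invr_ge0 ltW. Qed.

Lemma row_bound_ge0 s : 0 <= row_bound s.
Proof.
elim: s => [|s IHs] /=; first by rewrite mulr_ge0.
by rewrite addr_ge0// !mulr_ge0 ?step_error_ge0// addr_ge0// ltW.
Qed.

Lemma row_le_rect s : row_bound s <= rect_bound s.
Proof.
elim: s => [//|s IHs] /=; apply: lerD.
  by rewrite ler_wpM2l// mulr_ge0// addr_ge0// ltW.
have := row_bound_ge0 s; have := step_error_ge0 s; set e := step_error s.
move=> e0 r0.
rewrite (_ : 16 * _ = 4 * (1 + th^-1) * (4 * 1)); last by ring.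
rewrite -mulrA ler_wpM2l ?mulr_ge0 ?addr_ge0//; lra.
Qed.

Let single_le_row s : K * (2 ^ s)%:R * m2 s <= row_bound s.
Proof.
case: s => [|s]; first by rewrite expn0 mulr1.
apply: (@le_trans _ _ (2 * step_error s)).
  rewrite expnS natrM (_ : _ * m2 _ = 2 * (K * (2 ^ s)%:R * m2 s.+1)).
    by rewrite ler_wpM2l.
  by ring.
rewrite /= ler_wpDl ?mulr_ge0 ?row_bound_ge0 ?addr_ge0 ?(ltW th0)//.
by rewrite ler_wpM2r ?step_error_ge0//; move: thV0; lra.
Qed.

Let measurable_row s a b m n :
  measurable_fun setT (fun w => rowmax (centered (F s) w) a b m n).
Proof. by apply: measurable_rowmax => i j; exact: measurable_centered. Qed.

Let measurable_rect s a b m n :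
  measurable_fun setT (fun w => rectmax (centered (F s) w) a b m n).
Proof. by apply: measurable_rectmax => i j; exact: measurable_centered. Qed.

Let measurable_blockF s a b m n :
  measurable_fun setT (fun w => `|rsum (centered (F s) w) a b m n|).
Proof. by apply: measurable_rsum_norm => i j; exact: measurable_centered. Qed.

Let measurable_blockG s a b m n :
  measurable_fun setT (fun w => `|rsum (centered (G s) w) a b m n|).
Proof. by apply: measurable_rsum_norm => i j; exact: measurable_centered. Qed.

Let rect_lower_level s w a b m n : (m * n = 2 ^ s)%N ->
  rectmax (centered (F s.+1) w) a b m n <=
  rectmax (centered (F s) w) a b m n +
  (`|rsum (centered (G s) w) a b m n| + (2 ^ s)%:R * mu s).
Proof.
move=> <-; rewrite (_ : centered (F s.+1) w =
    fun i j => centered (F s) w i j + centered (G s) w i j); last first.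
  by apply/funext => i; apply/funext => j; exact: centeredF.
apply: le_trans (rectmaxD _ _ _ _ _ _) _; rewrite lerD2l.
by apply: rectmax_centered_le => // i j; exact: G_mean.
Qed.

Let row_lower_level s w a b m n : (m * n = 2 ^ s)%N ->
  rowmax (centered (F s.+1) w) a b m n <=
  rowmax (centered (F s) w) a b m n +
  (`|rsum (centered (G s) w) a b m n| + (2 ^ s)%:R * mu s).
Proof.
move=> <-; rewrite (_ : centered (F s.+1) w =
    fun i j => centered (F s) w i j + centered (G s) w i j); last first.
  by apply/funext => i; apply/funext => j; exact: centeredF.
apply: le_trans (rowmaxD _ _ _ _ _ _) _; rewrite lerD2l.
apply: le_trans (rectmax_ge_row _ _ _ _ (leqnn m)) _.
by apply: rectmax_centered_le => // i j; exact: G_mean.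
Qed.

(** Halve the set of columns and lower the truncation level of each half by one
    step; the layer removed is nonnegative and contributes through its block sum
    and its mean only. *)
Lemma row_chaining l j a b :
  ('E_P[fun w => (rowmax (centered (F (j + l)) w) a b (2 ^ j) (2 ^ l) ^+ 2)%R]
    <= (row_bound (j + l))%:E)%E.
Proof.
elim: l a b => [|l IHl] a b.
  rewrite addn0 expn0.
  apply: (@le_trans _ _ (K * (2 ^ j * 1)%:R * m2 j)%:E); last first.
    by rewrite muln1 lee_fin single_le_row.
  apply: le_trans (blockF j a b (2 ^ j) 1).
  apply: expectation_mono => w; first exact: sqr_ge0.
  rewrite -[leRHS]real_normK ?num_real// ler_sqr ?nnegrE ?rowmax_ge0//.
  apply: rowmax_le => // -[|[|//]] _ //.
  rewrite (_ : rsum _ _ _ _ 0 = 0) ?normr0//.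
  by rewrite /rsum big1// => i _; rewrite big_ord0.
set s := (j + l)%N; rewrite addnS -/s expnS mul2n -addnn.
have mn : (2 ^ j * 2 ^ l = 2 ^ s)%N by rewrite -expnD.
have := @expectation_max_step _ _ _ P th (row_bound s)
  (K * (2 ^ s)%:R * m2 s.+1) ((2 ^ s)%:R * mu s)
  (fun w => rowmax (centered (F s.+1) w) a b (2 ^ j) (2 ^ l + 2 ^ l))
  (fun w => rowmax (centered (F s) w) a b (2 ^ j) (2 ^ l))
  (fun w => rowmax (centered (F s) w) a (b + 2 ^ l) (2 ^ j) (2 ^ l))
  (fun w => `|rsum (centered (F s.+1) w) a b (2 ^ j) (2 ^ l)|)
  (fun w => `|rsum (centered (G s) w) a b (2 ^ j) (2 ^ l)|)
  (fun w => `|rsum (centered (G s) w) a (b + 2 ^ l) (2 ^ j) (2 ^ l)|) th0.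
have norm2 (f : R -> R) a' b' : (fun w =>
    `|rsum (centered f w) a' b' (2 ^ j) (2 ^ l)| ^+ 2) =
    fun w => rsum (centered f w) a' b' (2 ^ j) (2 ^ l) ^+ 2.
  by apply/funext => w; rewrite real_normK ?num_real.
rewrite !norm2 => H; apply: le_trans (H _ _ _ _ _ _ _ _ _ _ _ _ _) _ => //.
- by move=> w; exact: rowmax_ge0.
- by move=> w; exact: rowmax_ge0.
- move=> w; rewrite rowmax_ge0/=; apply: le_trans (rowmax_split _ _ _ _ _ _) _.
  have h1 := row_lower_level w a b mn.
  have h2 := row_lower_level w a (b + 2 ^ l) mn.
  have n1 := normr_ge0 (rsum (centered (G s) w) a b (2 ^ j) (2 ^ l)).
  have n2 := normr_ge0 (rsum (centered (G s) w) a (b + 2 ^ l) (2 ^ j) (2 ^ l)).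
  have m1 : rowmax (centered (F s) w) a b (2 ^ j) (2 ^ l) <= Num.max
    (rowmax (centered (F s) w) a b (2 ^ j) (2 ^ l))
    (rowmax (centered (F s) w) a (b + 2 ^ l) (2 ^ j) (2 ^ l)).
    by rewrite le_max lexx.
  have m1' : rowmax (centered (F s) w) a (b + 2 ^ l) (2 ^ j) (2 ^ l) <= Num.max
    (rowmax (centered (F s) w) a b (2 ^ j) (2 ^ l))
    (rowmax (centered (F s) w) a (b + 2 ^ l) (2 ^ j) (2 ^ l)).
    by rewrite le_max lexx orbT.
  by rewrite {1}/Num.max; case: ifP => _; lra.
- by rewrite -mn; exact: blockF.
- by rewrite -mn; exact: blockG.
- by rewrite -mn; exact: blockG.
rewrite lee_fin /= [(1 + th) * (2 * _)]mulrCA mulrA lerD2l.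
rewrite (_ : 16 * (1 + th^-1) * _ = 4 * (1 + th^-1) * (4 * step_error s));
  last by ring.
rewrite ler_wpM2l ?mulr_ge0 ?addr_ge0//.
by have := Km2_le s; have := mu2_le s; have := step_error_ge0 s; lra.
Qed.

(** Halve the set of rows, down to a single row, where [row_chaining]
    takes over.  The step costs a one-directional maximum over the upper half,
    already estimated, and the layers between two consecutive levels; the layer
    of the upper half occurs twice, once for each of the two maxima over it. *)
Lemma rect_chaining j l a b :
  ('E_P[fun w => (rectmax (centered (F (j + l)) w) a b (2 ^ j) (2 ^ l) ^+ 2)%R]
    <= (rect_bound (j + l))%:E)%E.
Proof.
elim: j a b => [|j IHj] a b.
  rewrite add0n expn0; apply: (@le_trans _ _ (row_bound l)%:E); last first.
    by rewrite lee_fin row_le_rect.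
  apply: le_trans (row_chaining l 0 a b); rewrite add0n expn0.
  apply: expectation_mono => w; first exact: sqr_ge0.
  rewrite ler_sqr ?nnegrE ?rowmax_ge0 ?rectmax_ge0//.
  apply: rectmax_le => [|u v]; first exact: rowmax_ge0.
  case: u => [_ _|[_ vl|//]]; last exact: rowmax_ge.
  by rewrite /rsum big_ord0 normr0 rowmax_ge0.
set s := (j + l)%N; rewrite addSn -/s expnS mul2n -addnn.
have mn : (2 ^ j * 2 ^ l = 2 ^ s)%N by rewrite -expnD.
have := @expectation_max_step _ _ _ P th (rect_bound s)
  (row_bound s + 4 * (K * (2 ^ s)%:R * m2 s.+1)) (2 * ((2 ^ s)%:R * mu s))
  (fun w => rectmax (centered (F s.+1) w) a b (2 ^ j + 2 ^ j) (2 ^ l))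
  (fun w => rectmax (centered (F s) w) a b (2 ^ j) (2 ^ l))
  (fun w => rectmax (centered (F s) w) (a + 2 ^ j) b (2 ^ j) (2 ^ l))
  (fun w => rowmax (centered (F s) w) a b (2 ^ j) (2 ^ l))
  (fun w => 2 * `|rsum (centered (G s) w) a b (2 ^ j) (2 ^ l)|)
  (fun w => `|rsum (centered (G s) w) (a + 2 ^ j) b (2 ^ j) (2 ^ l)|) th0.
have norm2 (f : R -> R) a' b' w :
    `|rsum (centered f w) a' b' (2 ^ j) (2 ^ l)| ^+ 2 =
    rsum (centered f w) a' b' (2 ^ j) (2 ^ l) ^+ 2.
  by rewrite real_normK ?num_real.
have Kge0 : 0 <= K * (2 ^ s)%:R * m2 s.+1 by rewrite !mulr_ge0.
move=> H; apply: le_trans (H _ _ _ _ _ _ _ _ _ _ _ _ _) _ => //.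
- by apply: measurable_funM => //; exact: measurable_cst.
- by move=> w; exact: rectmax_ge0.
- by move=> w; exact: rectmax_ge0.
- move=> w; rewrite rectmax_ge0/=; apply: le_trans (rectmax_split _ _ _ _ _ _) _.
  have h1 := rect_lower_level w a b mn.
  have h2 := rect_lower_level w (a + 2 ^ j) b mn.
  have h3 := row_lower_level w a b mn.
  have n1 := normr_ge0 (rsum (centered (G s) w) a b (2 ^ j) (2 ^ l)).
  have n2 := normr_ge0 (rsum (centered (G s) w) (a + 2 ^ j) b (2 ^ j) (2 ^ l)).
  have m1 : rectmax (centered (F s) w) a b (2 ^ j) (2 ^ l) <= Num.max
    (rectmax (centered (F s) w) a b (2 ^ j) (2 ^ l))
    (rectmax (centered (F s) w) (a + 2 ^ j) b (2 ^ j) (2 ^ l)).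
    by rewrite le_max lexx.
  have m1' : rectmax (centered (F s) w) (a + 2 ^ j) b (2 ^ j) (2 ^ l) <= Num.max
    (rectmax (centered (F s) w) a b (2 ^ j) (2 ^ l))
    (rectmax (centered (F s) w) (a + 2 ^ j) b (2 ^ j) (2 ^ l)).
    by rewrite le_max lexx orbT.
  by rewrite {1}/Num.max; case: ifP => _; lra.
- by apply: le_trans (row_chaining l j a b) _; rewrite lee_fin lerDl mulr_ge0.
- apply: (@le_trans _ _ (4 * (K * (2 ^ s)%:R * m2 s.+1))%:E); last first.
    by rewrite lee_fin lerDr row_bound_ge0.
  apply: (expectation_scale
    (g := fun w => rsum (centered (G s) w) a b (2 ^ j) (2 ^ l) ^+ 2)) => //.
  + apply: measurable_funX; apply: measurable_rsum => i k.
    exact: measurable_centered.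
  + by move=> w; exact: sqr_ge0.
  + by move=> w; rewrite exprMn norm2 -natrX.
  + by rewrite -mn; exact: blockG.
- apply: (@le_trans _ _ (K * (2 ^ s)%:R * m2 s.+1)%:E).
    under eq_fun do rewrite norm2.
    by rewrite -mn; exact: blockG.
  by rewrite lee_fin; have := row_bound_ge0 s; lra.
rewrite lee_fin /= [(1 + th) * (2 * _)]mulrCA mulrA lerD2l.
rewrite ler_wpM2l ?mulr_ge0 ?addr_ge0// exprMn /step_error.
by have := sqr_ge0 ((2 ^ s)%:R * mu s); lra.
Qed.

End levels.
End chaining.

(** * Interpolation between first and second powers *)

Section kfunctional.
Context {R : realType}.
Implicit Types (t x z : R).

(** Quadratic up to [t] and linear beyond.  A cut at height [t] carries
    moments of this function from the terms to their sum, and [x ^ p] is a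
    mixture of these functions when [1 < p < 2]. *)
Definition kfun t x : R := Num.min (x ^+ 2) (t * x).

Lemma kfun_ge0 t x : 0 <= t -> 0 <= x -> 0 <= kfun t x.
Proof. by move=> t0 x0; rewrite /kfun le_min sqr_ge0 mulr_ge0. Qed.

Lemma kfun_homo t x z : 0 <= t -> 0 <= x -> x <= z -> kfun t x <= kfun t z.
Proof.
move=> t0 x0 xz; rewrite /kfun le_min !ge_min.
by rewrite ler_sqr ?nnegrE ?(le_trans x0)// xz ler_wpM2l ?orbT.
Qed.

(** A sum is at most twice its larger term: the quadratic branch serves when
    the square-integrable part [x] is the larger, the linear branch otherwise. *)
Lemma kfun_add t x z : 0 <= t -> kfun t `|x + z| <= 4 * x ^+ 2 + 2 * t * `|z|.
Proof.
move=> t0; rewrite /kfun ge_min; have := ler_normD x z.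
have [zx|/ltW xz] := leP `|z| `|x| => xzn.
  apply/orP; left; apply: ler_wpDr; first by rewrite !mulr_ge0.
  rewrite -[x ^+ 2]real_normK ?num_real//.
  rewrite (_ : 4 * _ = (2 * `|x|) ^+ 2); last by ring.
  by rewrite ler_sqr ?nnegrE ?mulr_ge0//; lra.
apply/orP; right; apply: ler_wpDl; first by rewrite mulr_ge0 ?sqr_ge0.
by rewrite -mulrA mulrCA ler_wpM2l//; lra.
Qed.

Lemma trunc_sqr_le_kfun t x : 0 <= t -> 0 <= x -> trunc t x ^+ 2 <= kfun t x.
Proof.
move=> t0 x0; have /andP[tr0 trt] := trunc_bounds x t0.
have trx : trunc t x <= x.
  by rewrite {2}(trunc_excess t0 x0) lerDl excess_ge0.
by rewrite /kfun le_min ler_sqr ?nnegrE// trx expr2 ler_pM.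
Qed.

Lemma excess_le_kfun t x : 0 <= t -> 0 <= x -> t * excess t x <= kfun t x.
Proof.
move=> t0 x0; have exx : excess t x <= x.
  by rewrite /excess ge_max x0 lerBlDr lerDl t0.
rewrite /kfun le_min ler_wpM2l// andbT /excess /Num.max.
case: ifPn => [_|]; first by rewrite mulr0 sqr_ge0.
by rewrite -leNgt subr_ge0 => tx; rewrite expr2 ler_pM ?subr_ge0// lerBlDr lerDl.
Qed.

Lemma kfun_continuous t : continuous (kfun t).
Proof.
move=> x; apply: (@continuous_min R R^o (fun y => y ^+ 2) (fun y => t * y) x).
  exact: exprn_continuous.
by apply: cvgM; [exact: cvg_cst|exact: cvg_id].
Qed.

Lemma exists_lt_two_expn (x : R) : exists n : nat, x < 2 ^+ n.
Proof.
exists (Num.truncn x).+1; apply: (lt_le_trans (truncnS_gt _)).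
by rewrite -natrX ler_nat ltnW// ltn_expl.
Qed.

Variable p : R.
Hypothesis hp : 1 < p < 2.

Lemma powR_homo q x z : 0 <= q -> 0 <= x -> x <= z -> x `^ q <= z `^ q.
Proof.
move=> q0 x0 xz; apply: ge0_ler_powR => //; rewrite nnegrE //.
exact: le_trans xz.
Qed.

Lemma powR_sub2 t : 0 < t -> t `^ (p - 2) * t = t `^ (p - 1).
Proof.
move=> t0; rewrite -{2}[t]powRr1 ?ltW// -powRD; last by apply/implyP => _; rewrite gt_eqF.
by congr (_ `^ _); ring.
Qed.

Lemma mul_powR_sub1 t : 0 < t -> t * t `^ (p - 1) = t `^ p.
Proof. by move=> t0; rewrite mulr_powRB1 ?ltW//; case/andP: hp; lra. Qed.

(** Collects the constants of two geometric sums, one growing with ratio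
    [2 `^ (p - 1) > 1], the other decaying with ratio [2 `^ (p - 2) < 1]. *)
Definition kfun_const : R := (2 `^ (p - 1) - 1)^-1 + 1 + (1 - 2 `^ (p - 2))^-1.

Lemma two_powR_gt1 : 1 < 2 `^ (p - 1).
Proof.
rewrite -[ltLHS](powRr0 2) /powR !ifF ?gt_eqF//.
by rewrite ltr_expR mul0r mulr_gt0 ?ln_gt0 ?ltr1n//; case/andP: hp; lra.
Qed.

Lemma two_powR_lt1 : 2 `^ (p - 2) < 1.
Proof.
rewrite -[ltRHS](powRr0 2) /powR !ifF ?gt_eqF//.
rewrite ltr_expR mul0r nmulr_rlt0 ?ln_gt0 ?ltr1n//.
by case/andP: hp; lra.
Qed.

Lemma kfun_const_gt0 : 0 < kfun_const.
Proof.
have h1 := two_powR_gt1; have h2 := two_powR_lt1.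
by rewrite !addr_gt0// invr_gt0 subr_gt0.
Qed.

Lemma powR_geo (b q : R) r : 0 < b ->
  (2 ^+ r.+1 * b) `^ q = 2 `^ q * (2 ^+ r * b) `^ q.
Proof.
by move=> b0; rewrite exprS -mulrA powRM// mulr_ge0 ?exprn_ge0// ltW.
Qed.

(** The terms grow geometrically with ratio [2 `^ (p - 1)] as long as the
    height is below [z], and decay geometrically with ratio [2 `^ (p - 2)] from
    then on, so the sum is comparable to its largest term, of order [z `^ p]. *)
Lemma kfun_sum_le (b z : R) n : 0 < b -> 0 <= z ->
  \sum_(r < n) (2 ^+ r * b) `^ (p - 2) * kfun (2 ^+ r * b) z <=
  kfun_const * z `^ p.
Proof.
move=> b0; rewrite le_eqVlt => /predU1P[<-|z0].
  rewrite big1 ?mulr_ge0 ?powR_ge0 ?ltW ?kfun_const_gt0// => r _.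
  by rewrite /kfun expr0n mulr0 minxx mulr0.
pose A : R := (2 `^ (p - 1) - 1)^-1; pose D : R := (1 - 2 `^ (p - 2))^-1.
have A0 : 0 < A by rewrite invr_gt0 subr_gt0 two_powR_gt1.
have D0 : 0 < D by rewrite invr_gt0 subr_gt0 two_powR_lt1.
have AE : A + 1 = A * 2 `^ (p - 1).
  have : A * (2 `^ (p - 1) - 1) = 1.
    by rewrite mulVf// gt_eqF// subr_gt0 two_powR_gt1.
  by rewrite mulrBr mulr1 => h; lra.
have DE : D = 1 + D * 2 `^ (p - 2).
  have : D * (1 - 2 `^ (p - 2)) = 1.
    by rewrite mulVf// gt_eqF// subr_gt0 two_powR_lt1.
  by rewrite mulrBr mulr1 => h; lra.
pose t r : R := 2 ^+ r * b.
have t0 r : 0 < t r by rewrite mulr_gt0 ?exprn_gt0.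
have t_mono r : t r <= t r.+1.
  by rewrite /t exprS ler_pM2r// ler_peMl ?exprn_ge0 ?ler1n.
have zp0 := powR_ge0 z p.
have low r : t r <= z -> z * t r `^ (p - 1) <= z `^ p.
  move=> trz; rewrite -mul_powR_sub1// ler_pM2l//.
  by apply: powR_homo => //; [case/andP: hp; lra|exact: ltW].
have high r : z < t r -> z ^+ 2 * t r `^ (p - 2) <= z `^ p.
  move=> ztr; rewrite -mul_powR_sub1// -(powR_sub2 z0) expr2 -mulrA ler_pM2l//.
  rewrite mulrC ler_pM2r// -[p - 2]opprB !powRN lef_pV2 ?posrE ?powR_gt0//.
  by apply: powR_homo; [case/andP: hp; lra|exact: ltW|exact: ltW].
(* potential: below z the sum is bounded by a multiple of its last term,
   above z the tail of the decreasing series is set aside in advance *)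
suff [S1 S2] : (t n <= z -> \sum_(r < n) t r `^ (p - 2) * kfun (t r) z <=
      A * (z * t n `^ (p - 1))) /\
    (z < t n -> \sum_(r < n) t r `^ (p - 2) * kfun (t r) z +
      D * (z ^+ 2 * t n `^ (p - 2)) <= kfun_const * z `^ p).
  have [tnz|ztn] := leP (t n) z.
    apply: (le_trans (S1 tnz)).
    apply: (@le_trans _ _ (A * z `^ p)); first by rewrite ler_pM2l// low.
    by rewrite ler_wpM2r// /kfun_const -/A -/D; lra.
  apply: le_trans (S2 ztn); rewrite lerDl; apply: mulr_ge0; first exact: ltW.
  by apply: mulr_ge0; rewrite ?powR_ge0 ?sqr_ge0.
elim: n => [|n [S1 S2]].
  rewrite big_ord0; split => [_|zt].
    by rewrite !mulr_ge0 ?powR_ge0 ?ltW.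
  rewrite add0r; apply: (@le_trans _ _ (D * z `^ p)).
    by rewrite ler_pM2l// high.
  by rewrite ler_wpM2r// /kfun_const -/A -/D; lra.
rewrite big_ord_recr /=.
have term1 : t n `^ (p - 2) * kfun (t n) z <= z * t n `^ (p - 1).
  rewrite -powR_sub2// [z * _]mulrC -mulrA ler_wpM2l ?powR_ge0//.
  by rewrite /kfun ge_min lexx orbT.
have term2 : t n `^ (p - 2) * kfun (t n) z <= z ^+ 2 * t n `^ (p - 2).
  by rewrite [leRHS]mulrC ler_wpM2l ?powR_ge0// /kfun ge_min lexx.
have t1E : t n.+1 `^ (p - 1) = 2 `^ (p - 1) * t n `^ (p - 1) by exact: powR_geo.
have t2E : t n.+1 `^ (p - 2) = 2 `^ (p - 2) * t n `^ (p - 2) by exact: powR_geo.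
have [tnz|ztn] := leP (t n) z; last first.
  split=> [tz|_]; first by have := lt_le_trans ztn (t_mono n); rewrite ltNge tz.
  apply: le_trans (S2 ztn); rewrite -addrA lerD2l.
  apply: le_trans (lerD term2 (lexx _)) _; rewrite t2E.
  by rewrite [X in _ <= X * _]DE le_eqVlt; apply/orP; left; apply/eqP; ring.
have {}S1 := S1 tnz; split=> [_|zt].
  apply: le_trans (lerD S1 term1) _; rewrite t1E.
  by rewrite (mulrCA z) [leRHS]mulrA -AE mulrDl mul1r.
apply: le_trans (lerD (lerD S1 term1) (ler_wpM2l (ltW D0) (high _ zt))) _.
have := low n tnz; rewrite /kfun_const -/A -/D => lo.
have := ler_wpM2l (ltW A0) lo; lra.
Qed.

(** A single dyadic height, the one just below [x], already recovers [x `^ p].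
    Heights start at [b], and below [b] the power is bounded linearly. *)
Lemma powR_le_kfun (b x : R) : 0 < b -> 0 <= x ->
  x `^ p <= b `^ (p - 1) * x \/
  exists r, x `^ p <= 2 * ((2 ^+ r * b) `^ (p - 2) * kfun (2 ^+ r * b) x).
Proof.
move=> b0; rewrite le_eqVlt => /predU1P[<-|x0].
  by left; rewrite mulr0 powR0// gt_eqF//; case/andP: hp; lra.
have p1 : 0 <= p - 1 by case/andP: hp; lra.
have [xb|bx] := leP x b.
  left; rewrite mulrC -mul_powR_sub1// ler_pM2l//.
  by apply: powR_homo => //; exact: ltW.
right.
have [r /andP[rx xr]] : exists r, 2 ^+ r * b <= x < 2 ^+ r.+1 * b.
  have ex : exists n : nat, x < 2 ^+ n * b.
    by have [n xn] := exists_lt_two_expn (x / b); exists n; rewrite -ltr_pdivrMr.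
  have [[|n] nx nmin] := ex_minnP ex.
    by move: nx; rewrite mul1r ltNge (ltW bx).
  exists n; rewrite nx andbT leNgt; apply/negP => /nmin.
  by rewrite ltnn.
exists r; have t0 : 0 < 2 ^+ r * b by rewrite mulr_gt0// exprn_gt0.
rewrite /kfun min_r; last by rewrite expr2 ler_pM2r.
set t := 2 ^+ r * b in t0 *.
rewrite (_ : 2 * _ = x * (2 * (t `^ (p - 2) * t))); last by ring.
rewrite powR_sub2// -mul_powR_sub1// ler_pM2l//.
apply: (@le_trans _ _ ((2 ^+ r.+1 * b) `^ (p - 1))).
  by apply: powR_homo => //; exact: ltW.
rewrite powR_geo// -/t ler_wpM2r ?powR_ge0//.
by apply: ler1_powR; [rewrite ler1n|case/andP: hp; lra].
Qed.

End kfunctional.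

(** * Moments of a single block sum *)

Section expectation_series.
Context {d : measure_display} {T : measurableType d} {R : realType}.
Context {P : probability T R}.

Lemma expectation_sum_le (I : Type) (s : seq I) (F : I -> T -> R) (e : I -> R) :
  (forall i, measurable_fun setT (F i)) -> (forall i w, 0 <= F i w) ->
  (forall i, 'E_P[F i] <= (e i)%:E)%E ->
  ('E_P[fun w => (\sum_(i <- s) F i w)%R] <= (\sum_(i <- s) e i)%:E)%E.
Proof.
move=> mF F0 Fe; elim: s => [|i s IHs].
  under eq_fun do rewrite big_nil.
  by rewrite expectation_const big_nil.
under eq_fun do rewrite big_cons; rewrite big_cons.
apply: expectation_add_le => //.
  exact: measurable_sum.
by move=> w; apply: sumr_ge0.
Qed.

(** A partial sum that dominates [f] may have a length depending on the
    point, so the expectation is bounded through the whole series. *)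
Lemma expectation_le_series (f : T -> R) (s : nat -> T -> R) (e : nat -> R)
    (C : R) :
  measurable_fun setT f -> (forall r, measurable_fun setT (s r)) ->
  (forall w, 0 <= f w) -> (forall r w, 0 <= s r w) ->
  (forall w, exists n, f w <= \sum_(r < n) s r w) ->
  (forall r, 'E_P[s r] <= (e r)%:E)%E ->
  (forall n, \sum_(r < n) e r <= C) ->
  ('E_P[f] <= C%:E)%E.
Proof.
move=> mf ms f0 s0 fs se eC.
have s0E r w : (0 <= (s r w)%:E)%E by rewrite lee_fin.
apply: (@le_trans _ _ (\int[P]_w (\sum_(0 <= r <oo) (s r w)%:E))%E).
  rewrite unlock; apply: ge0_le_integral => //.
  - by move=> w _; rewrite lee_fin.
  - exact/measurable_EFinP.
  - apply: ge0_emeasurable_sum => [r w _ _|r _]; first exact: s0E.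
    exact/measurable_EFinP.
  - move=> w _; have [n fn] := fs w.
    apply: (@le_trans _ _ (\sum_(0 <= r < n) (s r w)%:E)%E).
      by rewrite sumEFin lee_fin big_mkord.
    exact: nneseries_lim_ge.
rewrite integral_nneseries//; last by move=> r; exact/measurable_EFinP.
apply: lime_le.
  by apply: is_cvg_nneseries => r _ _; exact: integral_ge0.
apply: nearW => n; apply: (@le_trans _ _ (\sum_(0 <= r < n) (e r)%:E)%E).
  by apply: lee_sum => r _; have := se r; rewrite unlock.
by rewrite sumEFin lee_fin big_mkord.
Qed.

Lemma expectation_lincomb k (c e : nat -> R) (F : nat -> T -> R) :
  (forall r, 0 <= c r) ->
  (forall r, measurable_fun setT (F r)) -> (forall r w, 0 <= F r w) ->
  (forall r, 'E_P[F r] = (e r)%:E)%E ->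
  ('E_P[fun w => (\sum_(r < k) c r * F r w)%R] =
    (\sum_(r < k) c r * e r)%:E)%E.
Proof.
move=> c0 mF F0 Fe; rewrite -sumEFin.
under [RHS]eq_bigr do rewrite EFinM -Fe.
rewrite unlock; under eq_integral do rewrite -sumEFin.
rewrite ge0_integral_sum//; last first.
- by move=> r w _; rewrite lee_fin mulr_ge0.
- move=> r; apply/measurable_EFinP; apply: measurable_funM => //.
apply: eq_bigr => r _; under eq_integral do rewrite EFinM.
rewrite ge0_integralZl_EFin//; last exact/measurable_EFinP.
by move=> w _; rewrite lee_fin.
Qed.

End expectation_series.

Section block_moments.
Context {d : measure_display} {T : measurableType d} {R : realType}.
Context {P : probability T R}.
Variables (Z : nat -> nat -> T -> R) (K : R).
Hypothesis mZ : forall i j, measurable_fun setT (Z i j).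
Hypothesis Z0 : forall i j w, 0 <= Z i j w.
Hypothesis K0 : 0 <= K.
Hypothesis hvar : variance_bound (P := P) Z K.

Variables (h : R -> R).
Hypothesis h_homo : {homo h : x y / x <= y}.
Hypothesis h0 : forall x, 0 <= h x.

(** Triangle inequality; both the sum and its centring contribute the mean. *)
Lemma block_first_moment (f : R -> R) (nu : R) a b m n :
  {homo f : x y / x <= y} -> (forall x, 0 <= f x) ->
  (forall i j, 'E_P[fun w => f (Z i j w)] <= nu%:E)%E ->
  ('E_P[fun w => (`|rsum (centered (P := P) Z f w) a b m n|)%R] <=
    (2 * (m * n)%:R * nu)%:E)%E.
Proof.
move=> fnd f0 fnu.
have nu0 : 0 <= nu.
  by have [/le_trans + + _] := fine_expectation_bounds
    (fun w => f0 (Z 0 0 w)) (fnu 0 0); exact.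
have mf i j := measurable_comp_homo mZ i j fnd.
pose S w := rsum (fun i j => f (Z i j w)) a b m n.
have S_le : ('E_P[S] <= ((m * n)%:R * nu)%:E)%E.
  rewrite -(rsum_cst nu a b); apply: expectation_sum_le => [i|i w|i].
  - exact: measurable_sum.
  - by apply: sumr_ge0.
  - by apply: expectation_sum_le.
have -> : 2 * (m * n)%:R * nu = 1 * ((m * n)%:R * nu) + 1 * ((m * n)%:R * nu).
  by ring.
apply: (expectation_comb (g := S) (h := fun=> (m * n)%:R * nu)) => //.
- by apply: measurable_rsum.
- by move=> w; apply: rsum_ge0.
- by move=> w; rewrite mulr_ge0.
- move=> w; rewrite !mul1r rsumB; apply: le_trans (ler_normB _ _) _.
  rewrite ger0_norm ?rsum_ge0// lerD2l -(rsum_cst nu a b).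
  rewrite ger0_norm; last first.
    apply: rsum_ge0 => i j.
    by have [] := fine_expectation_bounds (fun w => f0 (Z i j w)) (fnu i j).
  apply: ler_rsum => i j.
  by have [] := fine_expectation_bounds (fun w => f0 (Z i j w)) (fnu i j).
- by rewrite expectation_const.
Qed.

(** Cut the terms at height [t]: the clipped parts are handled by the variance
    bound, the excesses by their first moments, and both estimates are moments
    of [kfun t]. *)
Lemma block_kfun (t mu kap : R) a b m n :
  0 < t ->
  (forall i j, 'E_P[fun w => h (Z i j w)] <= mu%:E)%E ->
  (forall i j, 'E_P[fun w => kfun t (h (Z i j w))] <= kap%:E)%E ->
  ('E_P[fun w => kfun t `|rsum (centered (P := P) Z h w) a b m n|] <=
    (4 * (K + 1) * (m * n)%:R * kap)%:E)%E.
Proof.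
move=> t0 hmu hkap.
pose g1 x := trunc t (h x); pose g2 x := excess t (h x).
have g1_homo : {homo g1 : x y / x <= y}.
  by move=> x y xy; apply: trunc_homo; exact: h_homo.
have g2_homo : {homo g2 : x y / x <= y}.
  by move=> x y xy; apply: excess_homo; exact: h_homo.
have g1b x : 0 <= g1 x <= t by apply: trunc_bounds; exact: ltW.
have g10 x : 0 <= g1 x by have /andP[] := g1b x.
have g20 x : 0 <= g2 x by exact: excess_ge0.
have hE x : h x = g1 x + g2 x by apply: trunc_excess => //; exact: ltW.
have g1_mean i j : ('E_P[fun w => g1 (Z i j w)] <= mu%:E)%E.
  apply: le_trans (hmu i j); apply: expectation_mono => w //.
  by rewrite [leRHS]hE lerDl.
have g2_mean i j : ('E_P[fun w => g2 (Z i j w)] <= (t^-1 * kap)%:E)%E.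
  apply: (expectation_scale (g := fun w => kfun t (h (Z i j w)))) => //.
  - by rewrite invr_ge0 ltW.
  - apply: (measurableT_comp (f := kfun t)); last exact: (measurable_comp_homo mZ i j h_homo).
    by apply: continuous_measurable_fun; exact: kfun_continuous.
  - by move=> w; apply: kfun_ge0 => //; exact: ltW.
  - by move=> w; rewrite ler_pdivlMl// excess_le_kfun// ltW.
have g1_sqr i j : ('E_P[fun w => (g1 (Z i j w) ^+ 2)%R] <= kap%:E)%E.
  apply: le_trans (hkap i j); apply: expectation_mono => w.
    exact: sqr_ge0.
  by apply: trunc_sqr_le_kfun => //; exact: ltW.
have cE w : centered (P := P) Z h w =
    fun i j => centered (P := P) Z g1 w i j + centered (P := P) Z g2 w i j.
  apply/funext => i; apply/funext => j.
  exact: centeredD g1_homo g2_homo _ _ (g1_mean i j) (g2_mean i j).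
have -> : 4 * (K + 1) * (m * n)%:R * kap =
    4 * (K * (m * n)%:R * kap) + 2 * t * (2 * (m * n)%:R * (t^-1 * kap)).
  by field; rewrite gt_eqF.
apply: (expectation_comb
  (g := fun w => rsum (centered (P := P) Z g1 w) a b m n ^+ 2)
  (h := fun w => `|rsum (centered (P := P) Z g2 w) a b m n|)) => //.
- by rewrite mulr_ge0// ltW.
- apply: measurable_funX; apply: measurable_rsum => i j.
  exact: measurable_centered.
- by apply: measurable_rsum_norm => i j; exact: measurable_centered.
- by move=> w; apply: kfun_ge0 => //; exact: ltW.
- by move=> w; exact: sqr_ge0.
- by move=> w; rewrite cE rsumD; apply: kfun_add; exact: ltW.
- exact: hvar g1_homo g1b g1_sqr.
- exact: block_first_moment.
Qed.

(** A von Bahr-Esseen type inequality obtained from second moments: integrate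
    [block_kfun] over dyadic heights.  The assumption on [ktot] is the
    corresponding sum for a single term. *)
Lemma block_pth_moment (p c mu ktot : R) (kap : nat -> R) a b m n :
  1 < p < 2 -> 0 < c ->
  (forall i j, 'E_P[fun w => h (Z i j w)] <= mu%:E)%E ->
  (forall r i j,
    'E_P[fun w => kfun (2 ^+ r * c) (h (Z i j w))] <= (kap r)%:E)%E ->
  (forall k, \sum_(r < k) (2 ^+ r * c) `^ (p - 2) * kap r <= ktot) ->
  ('E_P[fun w => (`|rsum (centered (P := P) Z h w) a b m n| `^ p)%R] <=
    ((m * n)%:R * (2 * c `^ (p - 1) * mu + 8 * (K + 1) * ktot))%:E)%E.
Proof.
move=> hp c0 hmu hkap ktotP.
pose W w := `|rsum (centered (P := P) Z h w) a b m n|.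
have mW : measurable_fun setT W.
  by apply: measurable_rsum_norm => i j; exact: measurable_centered.
have W0 w : 0 <= W w by exact: normr_ge0.
pose t r : R := 2 ^+ r * c.
have t0 r : 0 < t r by rewrite mulr_gt0 ?exprn_gt0.
(* the linear bound valid below c is placed in front of the series *)
pose s r w := if r is r'.+1 then 2 * (t r') `^ (p - 2) * kfun (t r') (W w)
  else c `^ (p - 1) * W w.
pose e r := if r is r'.+1 then
    2 * (t r') `^ (p - 2) * (4 * (K + 1) * (m * n)%:R * kap r')
  else c `^ (p - 1) * (2 * (m * n)%:R * mu).
have mkf r : measurable_fun setT (fun w => kfun (t r) (W w)).
  apply: (measurableT_comp (f := kfun (t r))) => //.
  by apply: continuous_measurable_fun; exact: kfun_continuous.
have kf0 r w : 0 <= kfun (t r) (W w) by apply: kfun_ge0 => //; exact: ltW.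
have ktot0 : 0 <= ktot by have := ktotP 0; rewrite big_ord0.
have mu0 : 0 <= mu.
  by have [/le_trans + + _] := fine_expectation_bounds
    (fun w => h0 (Z 0 0 w)) (hmu 0 0); exact.
have s_ge0 r w : 0 <= s r w.
  by case: r => [|r]; rewrite /s !mulr_ge0// powR_ge0.
apply: (expectation_le_series (s := s) (e := e)).
- apply: (measurableT_comp (f := fun x => x `^ p)) => //.
- by case=> [|r]; apply: measurable_funM => //; exact: measurable_cst.
- by move=> w; exact: powR_ge0.
- exact: s_ge0.
- move=> w; have [lin|[r Wr]] := powR_le_kfun hp c0 (W0 w).
    by exists 1; rewrite big_ord1.
  exists r.+2; rewrite big_ord_recr/=; apply: ler_wpDl; first apply: sumr_ge0.
    by move=> i _; exact: s_ge0.
  by rewrite -mulrA.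
- case=> [|r] /=.
    apply: (expectation_scale (g := W)) => //; first exact: powR_ge0.
    exact: (block_first_moment a b m n h_homo h0 hmu).
  apply: (expectation_scale (g := fun w => kfun (t r) (W w))) => //.
  + by rewrite mulr_ge0// powR_ge0.
  + exact: (block_kfun a b m n (t0 r) hmu (hkap r)).
- case=> [|k].
    rewrite big_ord0 mulr_ge0// addr_ge0// ?mulr_ge0 ?powR_ge0//.
    by rewrite addr_ge0.
  rewrite big_ord_recl/= [leRHS]mulrDr; apply: lerD.
    by rewrite le_eqVlt; apply/orP; left; apply/eqP; ring.
  apply: (@le_trans _ _ ((m * n)%:R * (8 * (K + 1) *
      \sum_(r < k) (t r) `^ (p - 2) * kap r))).
    rewrite mulrA mulr_sumr; apply: ler_sum => r _.
    by rewrite le_eqVlt; apply/orP; left; apply/eqP; ring.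
  by rewrite ler_wpM2l// ler_wpM2l// mulr_ge0// addr_ge0.
Qed.

End block_moments.

(** * Truncation levels and their limits *)

Section sequences_to_zero.
Context {R : realType}.

(** Once the perturbation is small, the recurrence contracts towards a small
    multiple of it. *)
Lemma cvg_linear_recurrence (rho : R) (u v : nat -> R) :
  0 <= rho < 1 -> (forall s, 0 <= u s) ->
  (forall s, u s.+1 <= rho * u s + v s) ->
  v s @[s --> \oo] --> (0 : R) -> u s @[s --> \oo] --> (0 : R).
Proof.
move=> /andP[rho0 rho1] u0 uS v_cvg; apply/cvgrPdist_le => e e0.
have e1 : 0 < e / 2 * (1 - rho) by rewrite mulr_gt0 ?divr_gt0 ?subr_gt0.
have [N _ vN] := cvgr0_norm_lt v v_cvg _ e1.
have uN k : u (N + k)%N <= rho ^+ k * u N + e / 2.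
  elim: k => [|k IHk].
    by rewrite addn0 expr0 mul1r lerDl divr_ge0// ltW.
  rewrite addnS; apply: le_trans (uS _) _.
  have /= vk := vN (N + k)%N (leq_addr _ _).
  apply: le_trans (lerD (ler_wpM2l rho0 IHk) (ltW (le_lt_trans (ler_norm _) vk))) _.
  by rewrite exprS; lra.
have rho_cvg : rho ^+ k * u N @[k --> \oo] --> (0 : R).
  rewrite -[0](mul0r (u N)); apply: cvgM; last exact: cvg_cst.
  by apply: cvg_expr; rewrite ger0_norm.
have e2 : 0 < e / 2 by rewrite divr_gt0.
have [M _ rhoM] := cvgr0_norm_lt _ rho_cvg _ e2.
exists (N + M)%N => // s /= NMs.
have Ns : (N <= s)%N by apply: leq_trans NMs; exact: leq_addr.
rewrite sub0r normrN ger0_norm// -(subnKC Ns); apply: le_trans (uN _) _.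
have /= := rhoM (s - N)%N _; rewrite leq_subRL// => /(_ NMs).
by move=> /(le_lt_trans (ler_norm _)) /ltW; lra.
Qed.

Lemma powR_expn (a q : R) n : 0 <= a -> (a ^+ n) `^ q = (a `^ q) ^+ n.
Proof. by move=> a0; rewrite -!powR_mulrn ?powR_ge0// powRAC. Qed.

End sequences_to_zero.

Section dominated.
Context {d : measure_display} {T : measurableType d} {R : realType}.
Context {P : probability T R}.

Lemma expectation_dominated_cvg0 (f : nat -> T -> R) (g : T -> R) :
  (forall n, measurable_fun setT (f n)) -> measurable_fun setT g ->
  (forall n w, 0 <= f n w <= g w) -> ('E_P[g] < +oo)%E ->
  (forall w, f n w @[n --> \oo] --> (0 : R)) ->
  fine 'E_P[f n]%E @[n --> \oo] --> (0 : R).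
Proof.
move=> mf mg fg Eg f_cvg; apply: fine_cvg.
have g0 w : 0 <= g w by have /andP[/le_trans + +] := fg 0%N w; exact.
have -> : 0%:E = (\int[P]_(w in setT) (cst 0 w : \bar R))%E.
  by rewrite integral0.
rewrite unlock; apply: (@dominated_cvg _ _ _ _ _ _ _ _ (EFin \o g)) => //.
- by move=> n; exact/measurable_EFinP.
- by move=> w _; apply: cvg_EFin; [exact: nearW|exact: f_cvg].
- apply/integrableP; split; first exact/measurable_EFinP.
  under eq_integral do rewrite /= ger0_norm//.
  by move: Eg; rewrite unlock.
- move=> n w _; have /andP[f0 fgn] := fg n w.
  by rewrite /= lee_fin ger0_norm.
Qed.

End dominated.

Section levels.
Context {R : realType}.
Variable p : R.
Hypothesis hp : 1 <= p < 2.

Let p0 : 0 < p. Proof. by case/andP: hp; lra. Qed.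

(** Chosen so that [level s `^ p] is the number [2 ^+ s] of cells: this is the
    normalization of a sum over that many cells. *)
Definition level (s : nat) : R := (2 `^ p^-1) ^+ s.

Lemma level_base_gt1 : 1 < 2 `^ p^-1 :> R.
Proof.
rewrite -[ltLHS](powRr0 2) /powR !ifF ?gt_eqF//.
by rewrite ltr_expR mul0r mulr_gt0 ?invr_gt0// ln_gt0 ?ltr1n.
Qed.

Lemma level_gt0 s : 0 < level s.
Proof. by rewrite exprn_gt0// powR_gt0. Qed.

Lemma level_homo s : level s <= level s.+1.
Proof. by rewrite /level exprS ler_peMl ?ltW ?level_gt0 ?level_base_gt1. Qed.

Lemma level_leq s s' : (s <= s')%N -> level s <= level s'.
Proof. by move=> ss'; rewrite ler_weXn2l// ltW// level_base_gt1. Qed.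

Lemma level_powR s : level s `^ p = 2 ^+ s.
Proof.
rewrite powR_expn ?powR_ge0// -powRrM mulVf ?gt_eqF// powRr1//.
Qed.

(** The point where [p < 2] enters the chaining: halving doubles the second
    moment of a maximum, and the square of the normalization grows faster. *)
Lemma level_square_base : 2 < (2 `^ p^-1) ^+ 2 :> R.
Proof.
rewrite -powR_mulrn ?powR_ge0// -powRrM -[ltLHS]powRr1//.
rewrite /powR !ifF ?gt_eqF// ltr_expR ltr_pM2r ?ln_gt0 ?ltr1n//.
by rewrite mulrC ltr_pdivlMr//; case/andP: hp; lra.
Qed.

Definition tail_powR (c x : R) : R := if c < x then x `^ p else 0.

Lemma tail_powR_ge0 c x : 0 <= tail_powR c x.
Proof. by rewrite /tail_powR; case: ifP => _ //; exact: powR_ge0. Qed.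

Lemma tail_powR_le c x : tail_powR c x <= x `^ p.
Proof. by rewrite /tail_powR; case: ifP => _ //; exact: powR_ge0. Qed.

(** Above [c], a first power is at most [c `^ (1 - p)] times a [p]-th power. *)
Lemma excess_le_tail_powR c x : 0 < c -> 0 <= x ->
  excess c x <= c `^ (1 - p) * tail_powR c x.
Proof.
move=> c0 x0; rewrite /tail_powR; case: ifP => [cx|/negbT]; last first.
  by rewrite -leNgt => xc; rewrite mulr0 /excess ge_max lexx subr_le0 xc.
have x1 : 0 < x by exact: lt_trans cx.
rewrite /excess max_l ?subr_ge0 ?(ltW cx)//.
apply: (@le_trans _ _ x); first by rewrite lerBlDr lerDl ltW.
have xE : x = x `^ (1 - p) * x `^ p.
  rewrite -powRD; last by apply/implyP => _; rewrite gt_eqF.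
  by rewrite subrK powRr1.
rewrite {1}xE ler_pM2r ?powR_gt0//.
rewrite -[1 - p]opprB !powRN lef_pV2 ?posrE ?powR_gt0//.
by apply: powR_homo; [case/andP: hp; lra|exact: ltW|exact: ltW].
Qed.

Lemma excess_powR_le_tail_powR c x : 0 < c -> 0 <= x ->
  excess c x `^ p <= tail_powR c x.
Proof.
move=> c0 x0; rewrite /tail_powR; case: ifP => [cx|/negbT].
  apply: powR_homo; [exact: ltW|exact: excess_ge0|].
  by rewrite /excess ge_max x0 lerBlDr lerDl ltW.
rewrite -leNgt => xc; rewrite /excess max_r ?subr_le0// powR0//.
by rewrite gt_eqF.
Qed.

Lemma trunc_sqr_le_powR c x : 0 < c -> 0 <= x ->
  c `^ (p - 2) * trunc c x ^+ 2 <= x `^ p.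
Proof.
move=> c0; rewrite le_eqVlt => /predU1P[<-|x0].
  rewrite /trunc maxxx min_l ?expr0n ?mulr0 ?powR_ge0//; exact: ltW.
have split2 t : 0 < t -> t `^ (p - 2) * t ^+ 2 = t `^ p.
  move=> t0; rewrite -powR_mulrn ?ltW// -powRD ?subrK//.
  by apply/implyP => _; rewrite gt_eqF.
rewrite /trunc max_l; last exact: ltW.
have [xc|cx] := leP x c.
  rewrite -(split2 x)// ler_wpM2r ?sqr_ge0//.
  rewrite -[p - 2]opprB !powRN lef_pV2 ?posrE ?powR_gt0//.
  by apply: powR_homo; [case/andP: hp; lra|exact: ltW|].
by rewrite split2//; apply: powR_homo; exact: ltW.
Qed.

End levels.

Section limits.
Context {R : realType} {d : measure_display} {T : measurableType d}.
Context {P : probability T R}.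
Variables (p : R) (Y : T -> R).
Hypothesis hp : 1 <= p < 2.
Hypothesis mY : measurable_fun setT Y.
Hypothesis Y0 : forall w, 0 <= Y w.
Hypothesis Yp : ('E_P[fun w => (Y w `^ p)%R] < +oo)%E.

Let p0 : 0 < p. Proof. by case/andP: hp; lra. Qed.

Definition tail_moment (c : R) : R := fine 'E_P[fun w => tail_powR p c (Y w)]%E.

(** The second moment after truncation, normalized so that it is dominated by
    the [p]-th moment for every level at once. *)
Definition trunc_moment (c : R) : R :=
  fine 'E_P[fun w => (c `^ (p - 2) * trunc c (Y w) ^+ 2)%R]%E.

Let measurable_powR_Y : measurable_fun setT (fun w => Y w `^ p).
Proof. by apply: (measurableT_comp (f := fun x => x `^ p)). Qed.

Lemma measurable_tail_powR c : measurable_fun setT (fun w => tail_powR p c (Y w)).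
Proof.
apply: measurable_fun_ifT => //.
exact: measurable_fun_ltr.
Qed.

Lemma measurable_trunc_sqr c :
  measurable_fun setT (fun w => c `^ (p - 2) * trunc c (Y w) ^+ 2).
Proof.
apply: measurable_funM => //; apply: measurable_funX.
apply: (measurableT_comp (f := trunc c)) => //.
by apply: nondecreasing_measurable => //; exact: trunc_homo.
Qed.

Let YpE : ('E_P[fun w => (Y w `^ p)%R])%E =
  (fine ('E_P[fun w => (Y w `^ p)%R])%E)%:E.
Proof.
rewrite fineK// ge0_fin_numE//; apply: expectation_ge0 => w.
exact: powR_ge0.
Qed.

Lemma tail_momentE c :
  ('E_P[fun w => tail_powR p c (Y w)] = (tail_moment c)%:E)%E.
Proof.
have EY : ('E_P[fun w => tail_powR p c (Y w)] <=
    (fine ('E_P[fun w => (Y w `^ p)%R])%E)%:E)%E.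
  rewrite -YpE; apply: expectation_mono => w; first exact: tail_powR_ge0.
  exact: tail_powR_le.
by have [] := fine_expectation_bounds (fun w => tail_powR_ge0 p c (Y w)) EY.
Qed.

Lemma trunc_momentE c : 0 < c ->
  ('E_P[fun w => (trunc c (Y w) ^+ 2)%R] <=
    (c `^ (2 - p) * trunc_moment c)%:E)%E.
Proof.
move=> c0; have sq0 w : 0 <= c `^ (p - 2) * trunc c (Y w) ^+ 2.
  by rewrite mulr_ge0 ?powR_ge0 ?sqr_ge0.
apply: (expectation_scale
  (g := fun w => c `^ (p - 2) * trunc c (Y w) ^+ 2)) => //.
- exact: powR_ge0.
- exact: measurable_trunc_sqr.
- by move=> w; exact: sqr_ge0.
- move=> w; rewrite mulrA -powRD; last by apply/implyP => _; rewrite gt_eqF.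
  by rewrite (_ : 2 - p + (p - 2) = 0) ?powRr0 ?mul1r//; ring.
have EY : ('E_P[fun w => (c `^ (p - 2) * trunc c (Y w) ^+ 2)%R] <=
    (fine ('E_P[fun w => (Y w `^ p)%R])%E)%:E)%E.
  rewrite -YpE; apply: expectation_mono => // w.
  exact: trunc_sqr_le_powR.
by have [_ _ ->] := fine_expectation_bounds sq0 EY.
Qed.

Lemma tail_moment_cvg0 : tail_moment (level p s) @[s --> \oo] --> (0 : R).
Proof.
apply: (expectation_dominated_cvg0 (f := fun s w => tail_powR p (level p s) (Y w))
  (g := fun w => Y w `^ p)) => //.
- by move=> s; exact: measurable_tail_powR.
- by move=> s w; rewrite tail_powR_ge0 tail_powR_le.
move=> w; have [N YN] := exists_lt_two_expn (Y w `^ p).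
apply: cvg_near_cst; exists N => // s /= Ns.
rewrite /tail_powR ifF//; apply/negbTE; rewrite -leNgt.
apply: le_trans (level_leq hp Ns); rewrite leNgt; apply/negP => NY.
move: YN; rewrite -(level_powR hp) ltNge => /negP; apply.
by apply: powR_homo; [exact: ltW|apply: ltW; exact: level_gt0|exact: ltW].
Qed.

(** Pointwise, the normalizing factor is a geometric sequence of ratio
    less than [1] because [p < 2]. *)
Lemma trunc_moment_cvg0 : trunc_moment (level p s) @[s --> \oo] --> (0 : R).
Proof.
apply: (expectation_dominated_cvg0
  (f := fun s w => level p s `^ (p - 2) * trunc (level p s) (Y w) ^+ 2)
  (g := fun w => Y w `^ p)) => //.
- by move=> s; exact: measurable_trunc_sqr.
- move=> s w; rewrite mulr_ge0 ?powR_ge0 ?sqr_ge0//=.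
  by apply: trunc_sqr_le_powR => //; exact: level_gt0.
move=> w; pose g : R := (2 `^ p^-1) `^ (p - 2).
have g1 : `|g| < 1.
  rewrite ger0_norm ?powR_ge0// -(powRr0 (2 `^ p^-1)) /g.
  rewrite {1 3}/powR !ifF ?gt_eqF ?powR_gt0// ltr_expR mul0r.
  rewrite nmulr_rlt0 ?ln_gt0 ?level_base_gt1//.
  by case/andP: hp; lra.
apply: (@squeeze_cvgr _ _ _ _ (fun=> 0) (fun s => g ^+ s * Y w ^+ 2)).
- apply: nearW => s; have /andP[t0 _] := trunc_bounds (Y w) (ltW (level_gt0 p s)).
  rewrite mulr_ge0 ?powR_ge0 ?sqr_ge0//= /level powR_expn ?powR_ge0// -/g.
  rewrite ler_wpM2l ?exprn_ge0 ?powR_ge0// ler_sqr ?nnegrE//.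
  by rewrite [leRHS](trunc_excess (ltW (level_gt0 p s)) (Y0 w)) lerDl excess_ge0.
- exact: cvg_cst.
rewrite -[0](mul0r (Y w ^+ 2)); apply: cvgM; last exact: cvg_cst.
exact: cvg_expr.
Qed.

End limits.

(** * Nonnegative arrays dominated by a variable with p-th moment *)

Section powR_inequalities.
Context {R : realType}.
Variable p : R.
Hypothesis hp : 1 <= p < 2.

Let p0 : 0 <= p. Proof. by case/andP: hp; lra. Qed.

Lemma powR_add3 (x y z : R) : 0 <= x -> 0 <= y -> 0 <= z ->
  (x + y + z) `^ p <= 3 `^ p * (x `^ p + y `^ p + z `^ p).
Proof.
move=> x0 y0 z0.
have key m : 0 <= m -> x <= m -> y <= m -> z <= m ->
    m `^ p <= x `^ p + y `^ p + z `^ p ->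
    (x + y + z) `^ p <= 3 `^ p * (x `^ p + y `^ p + z `^ p).
  move=> m0 xm ym zm mp; apply: (@le_trans _ _ ((3 * m) `^ p)).
    by apply: powR_homo => //; [rewrite !addr_ge0|lra].
  by rewrite powRM// ler_wpM2l ?powR_ge0.
have := powR_ge0 x p; have := powR_ge0 y p; have := powR_ge0 z p => xp yp zp.
have [xy|/ltW yx] := leP x y; [have [yz|/ltW zy] := leP y z|
  have [xz|/ltW zx] := leP x z].
- by apply: (key z) => //; [exact: le_trans xy _|lra].
- by apply: (key y) => //; lra.
- by apply: (key z) => //; [exact: le_trans yx _|lra].
- by apply: (key x) => //; lra.
Qed.

(** Second moments control [p]-th moments at the price of a threshold [eta],
    which will be a small multiple of the normalization. *)
Lemma powR_le_sqr (eta x : R) : 0 < eta -> 0 <= x ->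
  x `^ p <= eta `^ p + eta `^ (p - 2) * x ^+ 2.
Proof.
move=> eta0 x0; have [xe|ex] := leP x eta.
  by apply: ler_wpDr; [rewrite mulr_ge0 ?powR_ge0 ?sqr_ge0|exact: powR_homo].
apply: ler_wpDl; first exact: powR_ge0.
have x1 : 0 < x by exact: lt_trans ex.
have -> : x `^ p = x `^ (p - 2) * x ^+ 2.
  rewrite -powR_mulrn// -powRD ?subrK//.
  by apply/implyP => _; rewrite gt_eqF.
rewrite ler_wpM2r ?sqr_ge0// -[p - 2]opprB !powRN lef_pV2 ?posrE ?powR_gt0//.
by apply: powR_homo; [case/andP: hp; lra|exact: ltW|exact: ltW].
Qed.

End powR_inequalities.

Section dominated_arrays.
Context {R : realType} {d d' : measure_display} {T : measurableType d}
  {T' : measurableType d'} {P : probability T R} {P' : probability T' R}.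
Variables (p : R) (Z : nat -> nat -> T -> R) (K : R) (Y : T' -> R).
Hypothesis hp : 1 <= p < 2.
Hypothesis mZ : forall i j, measurable_fun setT (Z i j).
Hypothesis Z0 : forall i j w, 0 <= Z i j w.
Hypothesis K0 : 0 <= K.
Hypothesis hvar : variance_bound (P := P) Z K.
Hypothesis mY : measurable_fun setT Y.
Hypothesis Y0 : forall w, 0 <= Y w.
Hypothesis Yp : ('E_P'[fun w => (Y w `^ p)%R] < +oo)%E.
Hypothesis ZY : forall i j (x : R),
  (P [set w | (x < Z i j w)%R] <= P' [set w | (x < Y w)%R])%E.

Let expectation_dom (g : R -> R) i j :
  {homo g : x y / x <= y} -> continuous g -> (forall x, 0 <= g x) ->
  ('E_P[fun w => g (Z i j w)] <= 'E_P'[fun w => g (Y w)])%E.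
Proof. exact: expectation_le_of_tails. Qed.

Let tau s := tail_moment (P := P') p Y (level p s).
Let sigma s := trunc_moment (P := P') p Y (level p s).
Let m2 s := level p s `^ (2 - p) * sigma s.
Let mu s := level p s `^ (1 - p) * tau s.

Let lvl0 s : 0 < level p s. Proof. exact: level_gt0. Qed.

Let tau0 s : 0 <= tau s.
Proof.
by apply: fine_ge0; apply: expectation_ge0 => w; exact: tail_powR_ge0.
Qed.

Let sigma0 s : 0 <= sigma s.
Proof.
apply: fine_ge0; apply: expectation_ge0 => w.
by rewrite mulr_ge0 ?powR_ge0 ?sqr_ge0.
Qed.

Let m2P s i j :
  ('E_P[fun w => (trunc (level p s) (Z i j w) ^+ 2)%R] <= (m2 s)%:E)%E.
Proof.
apply: le_trans (trunc_momentE hp mY Y0 Yp (lvl0 s)).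
apply: (expectation_dom (g := fun x => trunc (level p s) x ^+ 2)).
- move=> x y xy; rewrite ler_sqr ?nnegrE.
  + exact: trunc_homo.
  + by have /andP[] := trunc_bounds x (ltW (lvl0 s)).
  + by have /andP[] := trunc_bounds y (ltW (lvl0 s)).
- move=> x; apply: (@continuous_comp _ _ _ (trunc (level p s)) (fun y => y ^+ 2)).
    exact: trunc_continuous.
  exact: exprn_continuous.
- by move=> x; exact: sqr_ge0.
Qed.

Let excess_Y s :
  ('E_P'[fun w => excess (level p s) (Y w)] <= (mu s)%:E)%E.
Proof.
apply: (expectation_scale (g := fun w => tail_powR p (level p s) (Y w))).
- exact: powR_ge0.
- exact: measurable_tail_powR.
- by move=> w; exact: excess_ge0.
- by move=> w; exact: tail_powR_ge0.
- by move=> w; exact: excess_le_tail_powR.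
- by rewrite tail_momentE.
Qed.

Let muP s i j :
  ('E_P[fun w => excess (level p s) (Z i j w)] <= (mu s)%:E)%E.
Proof.
apply: le_trans (excess_Y s); apply: expectation_dom.
- exact: excess_homo.
- exact: excess_continuous.
- by move=> x; exact: excess_ge0.
Qed.

Let two_level s : (2 ^ s)%:R = level p s `^ p :> R.
Proof. by rewrite level_powR// natrX. Qed.

(** The total mean of the excesses is a vanishing fraction [tau] of the
    normalization. *)
Let mass_mu s : (2 ^ s)%:R * mu s = level p s * tau s.
Proof.
rewrite two_level /mu mulrA -powRD; last by apply/implyP => _; rewrite gt_eqF.
by rewrite addrC subrK powRr1// ltW.
Qed.

(** For [p = 1] the first moment is enough; for [1 < p] the sum required by
    [block_pth_moment] is estimated after passing from [Z] to [Y]. *)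
Lemma tail_block_moment : exists2 C : R, 0 <= C & forall s a b m n,
  (m * n = 2 ^ s)%N ->
  ('E_P[fun w => (`|rsum (centered (P := P) Z (excess (level p s)) w) a b m n|
      `^ p)%R] <= ((2 ^ s)%:R * (C * tau s))%:E)%E.
Proof.
have [/andP[]] := hp; rewrite le_eqVlt => /predU1P[p1 _|p1 p2].
  (* the factor 2 is that of the triangle inequality *)
  exists 2 => // s a b m n mn.
  under eq_fun do rewrite -[X in _ `^ X]p1 powRr1//.
  apply: le_trans (block_first_moment mZ a b m n (@excess_homo _ _)
    (@excess_ge0 _ _) (muP s)) _.
  rewrite lee_fin mn -mulrA mass_mu two_level -[X in _ `^ X]p1 powRr1 ?(ltW (lvl0 s))//.
  by rewrite mulrCA.
have hp' : 1 < p < 2 by rewrite p1.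
exists (2 + 8 * (K + 1) * kfun_const p).
  apply: addr_ge0 => //; apply: mulr_ge0; last exact: ltW (kfun_const_gt0 hp').
  by rewrite mulr_ge0// addr_ge0.
move=> s a b m n mn; pose c := level p s.
pose kap r := fine 'E_P'[fun w => kfun (2 ^+ r * c) (excess c (Y w))]%E.
have t0 r : 0 <= 2 ^+ r * c by rewrite mulr_ge0 ?exprn_ge0// ltW// lvl0.
have mexc : measurable_fun setT (fun w => excess c (Y w)).
  apply: (measurableT_comp (f := excess c)) => //.
  by apply: nondecreasing_measurable => //; exact: excess_homo.
have mkf r : measurable_fun setT (fun w => kfun (2 ^+ r * c) (excess c (Y w))).
  apply: (measurableT_comp (f := kfun (2 ^+ r * c))) => //.
  by apply: continuous_measurable_fun; exact: kfun_continuous.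
have kf0 r w : 0 <= kfun (2 ^+ r * c) (excess c (Y w)).
  by apply: kfun_ge0 => //; exact: excess_ge0.
have kapE r : ('E_P'[fun w => kfun (2 ^+ r * c) (excess c (Y w))] =
    (kap r)%:E)%E.
  have EY : ('E_P'[fun w => kfun (2 ^+ r * c) (excess c (Y w))] <=
      (2 ^+ r * c * mu s)%:E)%E.
    apply: (expectation_scale (g := fun w => excess c (Y w))) => //.
    - by move=> w; exact: excess_ge0.
    - by move=> w; rewrite /kfun ge_min lexx orbT.
    - exact: excess_Y.
  by have [] := fine_expectation_bounds (kf0 r) EY.
have kapP r i j :
    ('E_P[fun w => kfun (2 ^+ r * c) (excess c (Z i j w))] <= (kap r)%:E)%E.
  rewrite -kapE.
  apply: (expectation_dom (g := fun x => kfun (2 ^+ r * c) (excess c x))).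
  - move=> x y xy; apply: kfun_homo => //; first exact: excess_ge0.
    exact: excess_homo.
  - move=> x; apply: (@continuous_comp _ _ _ (excess c) (kfun (2 ^+ r * c))).
      exact: excess_continuous.
    exact: kfun_continuous.
  - by move=> x; apply: kfun_ge0 => //; exact: excess_ge0.
have ktot k : \sum_(r < k) (2 ^+ r * c) `^ (p - 2) * kap r <=
    kfun_const p * tau s.
  rewrite -lee_fin -(expectation_lincomb
    (c := fun r => (2 ^+ r * c) `^ (p - 2)) k _ mkf kf0 kapE); last first.
    by move=> r; exact: powR_ge0.
  apply: (expectation_scale (g := fun w => tail_powR p c (Y w))).
  - exact: ltW (kfun_const_gt0 hp').
  - exact: measurable_tail_powR.
  - by move=> w; apply: sumr_ge0 => r _; rewrite mulr_ge0 ?powR_ge0.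
  - by move=> w; exact: tail_powR_ge0.
  - move=> w; apply: le_trans (kfun_sum_le _ _ _ _) _ => //.
    + exact: lvl0.
    + exact: excess_ge0.
    apply: ler_wpM2l; first exact: ltW (kfun_const_gt0 hp').
    by apply: excess_powR_le_tail_powR => //; exact: lvl0.
  - by rewrite tail_momentE.
apply: le_trans (block_pth_moment mZ Z0 K0 hvar (@excess_homo _ _)
  (@excess_ge0 _ _) a b m n hp' (lvl0 s) (muP s) kapP ktot) _.
rewrite mn lee_fin ler_wpM2l// /mu le_eqVlt; apply/orP; left; apply/eqP.
have cE : level p s `^ (p - 1) * level p s `^ (1 - p) = 1.
  rewrite -powRD; last by apply/implyP => _; rewrite gt_eqF.
  by rewrite addrA subrK subrr powRr0.
transitivity (2 * (level p s `^ (p - 1) * level p s `^ (1 - p)) * tau s +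
  8 * (K + 1) * (kfun_const p * tau s)); first by rewrite /c; ring.
by rewrite cE; ring.
Qed.

Let base2 : R := (2 `^ p^-1) ^+ 2.

(** Half of the bound below which [rho] is less than [1]. *)
Let th : R := (base2 / 2 - 1) / 2.

Let th0 : 0 < th.
Proof. by have := level_square_base hp; rewrite -/base2 /th; lra. Qed.

Let rho : R := 2 * (1 + th) / base2.

Let base2_gt0 : 0 < base2. Proof. by have := level_square_base hp; apply: lt_trans. Qed.

Let rho_lt1 : 0 <= rho < 1.
Proof.
apply/andP; split; first by rewrite divr_ge0 ?mulr_ge0 ?addr_ge0 ?ltW.
rewrite ltr_pdivrMr// mul1r /th; have := level_square_base hp.
by rewrite -/base2; lra.
Qed.

Let level_sqrS s : level p s.+1 ^+ 2 = base2 * level p s ^+ 2.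
Proof. by rewrite /level (exprS _ s) exprMn. Qed.

(** Bound for [step_error] divided by the squared normalization. *)
Let err s := K * sigma s.+1 + tau s ^+ 2.

Let err_cvg : err s @[s --> \oo] --> (0 : R).
Proof.
rewrite -[0](addr0 0); apply: cvgD.
  rewrite -[0](mulr0 K); apply: cvgM; first exact: cvg_cst.
  by move: (trunc_moment_cvg0 hp mY Y0 Yp); rewrite -cvg_shiftS.
have t_cvg := tail_moment_cvg0 hp mY Yp.
have tt := cvgM t_cvg t_cvg; rewrite mulr0 in tt. exact: tt.
Qed.

Let row s := row_bound K m2 mu th s.
Let rect s := rect_bound K m2 mu th s.

Let step_error_le s : step_error K m2 mu s <= level p s.+1 ^+ 2 * err s.
Proof.
rewrite /step_error /err mulrDr; apply: lerD.
  have cE : level p s.+1 ^+ 2 = level p s.+1 `^ p * level p s.+1 `^ (2 - p).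
    rewrite -powRD; last by apply/implyP => _; rewrite gt_eqF.
    by rewrite addrC subrK -powR_mulrn ?ltW.
  rewrite (_ : level p s.+1 ^+ 2 * _ =
      K * level p s.+1 `^ p * m2 s.+1); last by rewrite /m2 cE; ring.
  rewrite ler_wpM2r ?mulr_ge0 ?powR_ge0// ler_wpM2l//.
  by rewrite level_powR// -natrX ler_nat leq_exp2l.
rewrite mass_mu exprMn ler_wpM2r ?sqr_ge0//.
by rewrite ler_sqr ?nnegrE ?(ltW (lvl0 _))// level_homo.
Qed.

Let row_ge0 s : 0 <= row s.
Proof. exact: (@row_bound_ge0 _ _ _ P Z K K0 (level p) m2 mu th th0 m2P s). Qed.

Let row_cvg : row s / level p s ^+ 2 @[s --> \oo] --> (0 : R).
Proof.
apply: (cvg_linear_recurrence (rho := rho)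
  (v := fun s => 16 * (1 + th^-1) * err s)) => //.
- by move=> s; rewrite divr_ge0 ?sqr_ge0.
- move=> s; rewrite /row /= ler_pdivrMr ?exprn_gt0// [leRHS]mulrDl.
  apply: lerD; last first.
    rewrite -[leRHS]mulrA ler_wpM2l ?mulr_ge0 ?addr_ge0 ?invr_ge0 ?(ltW th0)//.
    by rewrite mulrC step_error_le.
  rewrite le_eqVlt; apply/orP; left; apply/eqP; rewrite /rho level_sqrS.
  by field; rewrite !gt_eqF.
- rewrite -[0](mulr0 (16 * (1 + th^-1))).
  by apply: cvgM; [exact: cvg_cst|exact: err_cvg].
Qed.

Let rect_cvg : rect s / level p s ^+ 2 @[s --> \oo] --> (0 : R).
Proof.
apply: (cvg_linear_recurrence (rho := rho) (v := fun s =>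
  4 * (1 + th^-1) * (3 * (row s / level p s ^+ 2) + 12 * err s))) => //.
- move=> s; rewrite divr_ge0 ?sqr_ge0//.
  apply: le_trans (@row_le_rect _ _ _ P Z K K0 (level p) m2 mu th th0 m2P s).
  exact: row_ge0.
- move=> s; rewrite /rect /= ler_pdivrMr ?exprn_gt0// [leRHS]mulrDl.
  apply: lerD; last first.
    rewrite -[leRHS]mulrA ler_wpM2l ?mulr_ge0 ?addr_ge0 ?invr_ge0 ?(ltW th0)//.
    rewrite [leRHS]mulrDl lerD//; last by rewrite -mulrA ler_wpM2l// mulrC step_error_le.
    rewrite -mulrA ler_wpM2l// -mulrA.
    rewrite ler_peMr ?row_ge0//.
    rewrite mulrC ler_pdivlMr ?exprn_gt0// mul1r.
    by rewrite ler_sqr ?nnegrE ?(ltW (lvl0 _))// level_homo.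
  rewrite le_eqVlt; apply/orP; left; apply/eqP; rewrite /rho level_sqrS.
  by field; rewrite !gt_eqF.
- rewrite -[0](mulr0 (4 * (1 + th^-1))).
  apply: cvgM; first exact: cvg_cst.
  rewrite -[0](addr0 0); apply: cvgD.
    rewrite -[0](mulr0 3).
    by apply: cvgM; [exact: cvg_cst|exact: row_cvg].
  rewrite -[0](mulr0 12).
  by apply: cvgM; [exact: cvg_cst|exact: err_cvg].
Qed.

(** The array splits into its truncation at the top level and an excess,
    whose maximal sum reduces to the full sum by monotonicity. *)
Let split_levels s j l w : (j + l)%N = s ->
  rectmax (centered (P := P) Z id w) 0 0 (2 ^ j) (2 ^ l) <=
  rectmax (centered (P := P) Z (trunc (level p s)) w) 0 0 (2 ^ j) (2 ^ l) +
  `|rsum (centered (P := P) Z (excess (level p s)) w) 0 0 (2 ^ j) (2 ^ l)| +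
  level p s * tau s.
Proof.
move=> jl; have c0 := lvl0 s; set c := level p s in c0 *.
have tr0 x : 0 <= trunc c x by have /andP[] := trunc_bounds x (ltW c0).
have tr_mean i j' : ('E_P[fun w => trunc c (Z i j' w)] <= c%:E)%E.
  rewrite -(expectation_const (P := P)); apply: expectation_mono => w' //.
  by have /andP[] := trunc_bounds (Z i j' w') (ltW c0).
rewrite (_ : centered Z id w = fun i k =>
    centered (P := P) Z (trunc c) w i k + centered (P := P) Z (excess c) w i k).
  apply: le_trans (rectmaxD _ _ _ _ _ _) _; rewrite -addrA lerD2l.
  rewrite /c -mass_mu -jl expnD; apply: rectmax_centered_le => [x|i k].
    exact: excess_ge0.
  exact: muP.
apply/funext => i; apply/funext => k.
apply: (@centeredD _ _ _ P Z mZ Z0 id (trunc c) (excess c) _ _ i k w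
  _ _ _ _ _ (tr_mean i k) (muP s i k)).
- by move=> x x0; apply: trunc_excess => //; exact: ltW.
- exact: trunc_homo.
- exact: excess_homo.
- exact: tr0.
- by move=> x; exact: excess_ge0.
Qed.

(** At scale [s], the truncated part is small in second moment by chaining,
    the excess is small in [p]-th moment, and the means are small compared with
    the normalization. *)
Theorem dominated_rectmax_moment (eps : R) : 0 < eps ->
  \forall s \near \oo, forall j l, (j + l)%N = s ->
  ('E_P[fun w =>
      (rectmax (centered (P := P) Z id w) 0 0 (2 ^ j) (2 ^ l) `^ p)%R] <=
    (eps * (2 ^ s)%:R)%:E)%E.
Proof.
move=> eps0; have [C C0 tailP] := tail_block_moment.
have three0 : 0 < 3 `^ p :> R by rewrite powR_gt0.
have p0 : 0 < p by case/andP: hp; lra.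
(* four terms of size D: truncated part, excess, threshold and means *)
pose D : R := eps / (4 * 3 `^ p).
have D0 : 0 < D by rewrite divr_gt0// mulr_gt0.
pose delta := D `^ p^-1.
have delta0 : 0 < delta by rewrite powR_gt0.
have deltaE : delta `^ p = D.
  by rewrite -powRrM mulVf ?gt_eqF// powRr1// ltW.
have tau_cvg : tau s @[s --> \oo] --> (0 : R) := tail_moment_cvg0 hp mY Yp.
have Ctau_cvg : C * tau s @[s --> \oo] --> (0 : R).
  by rewrite -[0](mulr0 C); apply: cvgM; [exact: cvg_cst|].
have rect_cvg' : delta `^ (p - 2) * (rect s / level p s ^+ 2) @[s --> \oo]
    --> (0 : R).
  by rewrite -[0](mulr0 (delta `^ (p - 2))); apply: cvgM; [exact: cvg_cst|].
near=> s => j l jl.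
have tau_s : tau s <= delta.
  apply: le_trans (ler_norm _) _; apply/ltW; near: s.
  exact: (cvgr0_norm_lt _ tau_cvg).
have Ctau_s : C * tau s <= D.
  apply: le_trans (ler_norm _) _; apply/ltW; near: s.
  exact: (cvgr0_norm_lt _ Ctau_cvg).
have rect_s : delta `^ (p - 2) * (rect s / level p s ^+ 2) <= D.
  apply: le_trans (ler_norm _) _; apply/ltW; near: s.
  exact: (cvgr0_norm_lt _ rect_cvg').
have mn : (2 ^ j * 2 ^ l = 2 ^ s)%N by rewrite -expnD jl.
have c0 := lvl0 s; set c := level p s in rect_s c0 *.
pose M w := rectmax (centered (P := P) Z (trunc c) w) 0 0 (2 ^ j) (2 ^ l).
pose W w := `|rsum (centered (P := P) Z (excess c) w) 0 0 (2 ^ j) (2 ^ l)|.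
have mM : measurable_fun setT M.
  apply: measurable_rectmax => i k; apply: measurable_centered => //.
  exact: trunc_homo.
have mW : measurable_fun setT W.
  apply: measurable_rsum_norm => i k; apply: measurable_centered => //.
  exact: excess_homo.
pose const := (c * delta) `^ p + (c * tau s) `^ p.
have mWp : measurable_fun setT (fun w => W w `^ p).
  by apply: (measurableT_comp (f := fun x => x `^ p)).
have EM : ('E_P[fun w => (M w ^+ 2)%R] <= (rect s)%:E)%E.
  rewrite /M /c /rect -jl; apply: rect_chaining => //.
  by move=> s'; exact: level_homo.
have EW : ('E_P[fun w => (W w `^ p + const)%R] <=
    ((2 ^ s)%:R * (C * tau s) + const)%:E)%E.
  apply: expectation_add_le => //.
  - by move=> w; exact: powR_ge0.
  - by move=> w; rewrite addr_ge0 ?powR_ge0.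
  - exact: tailP.
  - by rewrite expectation_const.
have cd0 : 0 < c * delta by rewrite mulr_gt0.
apply: (@le_trans _ _ (3 `^ p * (c * delta) `^ (p - 2) * rect s +
    3 `^ p * ((2 ^ s)%:R * (C * tau s) + const))%:E).
  apply: (expectation_comb (g := fun w => M w ^+ 2)
    (h := fun w => W w `^ p + const)) => //.
  - by rewrite mulr_ge0 ?powR_ge0.
  - exact: measurable_funX.
  - exact: measurable_funD.
  - by move=> w; exact: powR_ge0.
  - by move=> w; exact: sqr_ge0.
  - by move=> w; rewrite !addr_ge0 ?powR_ge0.
  - move=> w; apply: le_trans (_ : (M w + W w + c * tau s) `^ p <= _).
      apply: powR_homo; [exact: ltW|exact: rectmax_ge0|exact: split_levels].
    have M0 : 0 <= M w by exact: rectmax_ge0.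
    have W0 : 0 <= W w by exact: normr_ge0.
    apply: le_trans (powR_add3 hp M0 W0 _) _; first by rewrite mulr_ge0// ltW.
    rewrite -mulrA -mulrDr ler_wpM2l ?(ltW three0)//.
    by have := powR_le_sqr hp cd0 M0; rewrite /const; lra.
rewrite lee_fin.
have cp : c `^ p = (2 ^ s)%:R by rewrite two_level.
have constE : const <= (2 ^ s)%:R * (D + D).
  rewrite /const !powRM ?(ltW c0) ?(ltW delta0)// cp deltaE mulrDr lerD2l.
  by rewrite ler_wpM2l// -deltaE powR_homo// ltW.
have rectE : (c * delta) `^ (p - 2) * rect s <= (2 ^ s)%:R * D.
  rewrite -cp powRM ?(ltW c0) ?(ltW delta0)//.
  have -> : c `^ p = c `^ (p - 2) * c ^+ 2.
    rewrite -powR_mulrn ?(ltW c0)// -powRD ?subrK//.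
    by apply/implyP => _; rewrite gt_eqF.
  have -> : rect s = c ^+ 2 * (rect s / c ^+ 2) by field; rewrite gt_eqF.
  rewrite (_ : _ * _ = c `^ (p - 2) * c ^+ 2 *
    (delta `^ (p - 2) * (rect s / c ^+ 2))); last by ring.
  by rewrite ler_wpM2l// mulr_ge0 ?powR_ge0 ?sqr_ge0.
rewrite -mulrA -mulrDr.
have -> : eps * (2 ^ s)%:R = 3 `^ p * ((2 ^ s)%:R * (4 * D)).
  by rewrite /D; field; rewrite gt_eqF.
rewrite ler_wpM2l ?(ltW three0)//.
have := ler_wpM2l (ler0n R (2 ^ s)) Ctau_s.
by move: constE rectE; lra.
Unshelve. all: by end_near.
Qed.

End dominated_arrays.

(** * From the moment condition to the signed parts *)

Section signed_parts.
Context {R : realType} {d : measure_display} {T : measurableType d}.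
Context {P : probability T R}.
Variable X : nat * nat -> {RV P >-> R}.

(** The positive part of [X] for [sg = 1] and its negative part for
    [sg = -1], with indices starting at [0]. *)
Definition signed_part (sg : R) (i j : nat) (w : T) : R :=
  Num.max (sg * X (i.+1, j.+1) w) 0.

Lemma part_ge0 sg i j w : 0 <= signed_part sg i j w.
Proof. by rewrite /signed_part le_max lexx orbT. Qed.

Lemma measurable_part sg i j : measurable_fun setT (signed_part sg i j).
Proof.
apply: measurable_maxr; last exact: measurable_cst.
by apply: measurable_funM => //; exact: measurable_cst.
Qed.

Definition rect_seq (a b m n : nat) : seq (nat * nat) :=
  [seq ((a + i).+1, (b + j).+1) | i <- iota 0 m, j <- iota 0 n].

Lemma rect_seq_uniq a b m n : uniq (rect_seq a b m n).
Proof.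
apply: allpairs_uniq; rewrite ?iota_uniq// => -[i j] [i' j'] _ _ /= [].
by move=> /addnI -> /addnI ->.
Qed.

Lemma big_rect_seq (F : nat * nat -> R) a b m n :
  \sum_(k <- rect_seq a b m n) F k =
  rsum (fun i j => F (i.+1, j.+1)) a b m n.
Proof.
rewrite /rect_seq big_allpairs_dep /rsum -[X in iota 0 X]subn0 -/(index_iota 0 m) big_mkord.
apply: eq_bigr => i _.
by rewrite -[X in iota 0 X]subn0 -/(index_iota 0 n) big_mkord.
Qed.

(** For the negative part, [f] of the part is the opposite of a
    nondecreasing function of [X]; the sign disappears in the square. *)
Lemma variance_bound_part (sg : R) : sg = 1 \/ sg = -1 ->
  condition_H2 posidx X ->
  exists2 K, 0 <= K & variance_bound (P := P) (signed_part sg) K.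
Proof.
move=> sg1 [C H]; exists (2 * `|C|) => [|f c B a b m n fnd fb fB].
  by rewrite mulr_ge0.
have B0 : 0 <= B.
  rewrite -lee_fin; apply: le_trans (fB 0%N 0%N); apply: expectation_ge0 => w.
  exact: sqr_ge0.
have sgsq x : (sg * x) ^+ 2 = x ^+ 2.
  by rewrite exprMn; case: sg1 => ->; rewrite ?sqrrN expr1n mul1r.
(* nondecreasing in x for both signs *)
pose g (_ : nat * nat) x := sg * f (Num.max (sg * x) 0).
pose I := [fset k in rect_seq a b m n]%fset.
have Iperm : perm_eq I (rect_seq a b m n).
  apply: uniq_perm; [exact: fset_uniq|exact: rect_seq_uniq|].
  by move=> k; rewrite in_fset.
have Icard : #|` I| = (m * n)%N.
  by rewrite (perm_size Iperm) size_allpairs !size_iota.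
have Imem k : k \in I -> exists i j, k = (i.+1, j.+1).
  rewrite in_fset => /allpairsP[[i j] /= [_ _ ->]].
  by exists (a + i)%N, (b + j)%N.
have Esq k : k \in I ->
    ('E_P[fun w => (g k (X k w) ^+ 2)%R] <= B%:E)%E.
  move=> /Imem[i [j ->]]; under eq_fun do rewrite /g sgsq.
  exact: fB.
have normsq k : (fun w => `|g k (X k w)| ^+ 2) = (fun w => g k (X k w) ^+ 2).
  by apply/funext => w; rewrite real_normK ?num_real.
have mf i j : measurable_fun setT (fun w => f (signed_part sg i j w)).
  by apply: measurable_comp_homo => // *; exact: measurable_part.
have f0 x : 0 <= f x by have /andP[] := fb x.
have fint i j : P.-integrable [set: T] (EFin \o (fun w => f (signed_part sg i j w))).
  apply: (integrable_of_expectation (A := c)) => //.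
  rewrite -(expectation_const (P := P)); apply: expectation_mono => // w.
  by have /andP[] := fb (signed_part sg i j w).
have gE i j : fine ('E_P[fun w => g (i.+1, j.+1) (X (i.+1, j.+1) w)])%E =
    sg * fine ('E_P[fun w => f (signed_part sg i j w)])%E.
  rewrite /g -/(signed_part sg i j _); case: sg1 => ->.
    by rewrite mul1r; under eq_fun do rewrite mul1r.
  rewrite unlock; under eq_integral do rewrite mulN1r EFinN.
  rewrite integral_ge0N => [|w _]; last by rewrite lee_fin.
  by rewrite fineN mulN1r.
have sumE w : \sum_(k <- I) (g k (X k w) - fine ('E_P[fun w' => g k (X k w')])%E) =
    sg * rsum (centered (P := P) (signed_part sg) f w) a b m n.
  rewrite (perm_big _ Iperm)/= big_rect_seq /rsum mulr_sumr.
  apply: eq_bigr => i _; rewrite mulr_sumr; apply: eq_bigr => j _.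
  by rewrite gE /centered mulrBr.
have max0_homo (x y : R) : x <= y -> Num.max x 0 <= Num.max y 0.
  by move=> xy; rewrite ge_max !le_max xy lexx orbT.
have g_homo k : k \in I -> {homo g k : x y / x <= y}.
  move=> _ x y xy; rewrite /g; case: sg1 => ->.
    by rewrite !mul1r; apply: fnd; apply: max0_homo.
  by rewrite !mulN1r lerN2; apply: fnd; apply: max0_homo; rewrite lerN2.
have g_int k : k \in I -> P.-integrable [set: T] (fun w => (g k (X k w))%:E).
  move=> /Imem[i [j ->]].
  have := integrableZl measurableT sg (fint i j).
  by apply: eq_integrable => // w _; rewrite /g EFinM.
have g_sqr k : k \in I -> ('E_P[fun w => (`|g k (X k w)| ^+ 2)%R] < +oo)%E.
  by move=> kI; rewrite normsq; apply: le_lt_trans (Esq k kI) _; rewrite ltry.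
have IP : [set` I] `<=` posidx by move=> k /= /Imem[i [j ->]].
have := H I g IP g_homo g_int g_sqr; rewrite Icard => {}H.
have -> : 'E_P[fun w => (rsum (centered (P := P) (signed_part sg) f w) a b m n ^+ 2)%R]%E =
    'E_P[fun w => (`|\sum_(k <- I)
      (g k (X k w) - fine ('E_P[fun w' => g k (X k w')])%E)| ^+ 2)%R]%E.
  congr expectation; apply/funext => w.
  by rewrite sumE real_normK ?num_real// sgsq.
apply: (le_trans H).
have max_le (F : nat * nat -> T -> R) : (forall k, k \in I ->
      ('E_P[fun w => F k w] <= B%:E)%E) ->
    (\big[maxe/0]_(k <- I) 'E_P[fun w => F k w] <= B%:E)%E.
  move=> FB; rewrite big_seq; apply: bigmax_le => //.
have max_ge (F : nat * nat -> T -> R) : (0 <= \big[maxe/0]_(k <- I) 'E_P[fun w => F k w])%E.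
  exact: bigmax_ge_id.
have M1 : (\big[maxe/0]_(k <- I) 'E_P[fun w => (`|g k (X k w)| ^+ 2)%R] <= B%:E)%E.
  by apply: max_le => k kI; rewrite normsq; exact: Esq.
have M2 : (\big[maxe/0]_(k <- I) 'E_P[fun w => (g k (X k w) ^+ 2)%R] <= B%:E)%E.
  by apply: max_le => k kI; exact: Esq.
have mn0 : (0 <= (m * n)%:R%:E :> \bar R)%E by rewrite lee_fin.
apply: (@le_trans _ _
    (`|C|%:E * ((m * n)%:R%:E * B%:E + (m * n)%:R%:E * B%:E))%E); last first.
  rewrite -[X in (_ * X)%E]/(((m * n)%:R * B + (m * n)%:R * B)%:E) -EFinM.
  by rewrite lee_fin le_eqVlt; apply/orP; left; apply/eqP; ring.
apply: (@le_trans _ _ (`|C|%:E * ((m * n)%:R%:E * \big[maxe/0]_(k <- I)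
      'E_P[fun w => (`|g k (X k w)| ^+ 2)%R] + (m * n)%:R%:E *
      \big[maxe/0]_(k <- I) 'E_P[fun w => (g k (X k w) ^+ 2)%R]))%E).
  apply: lee_wpmul2r; last by rewrite lee_fin ler_norm.
  by rewrite adde_ge0// mule_ge0// max_ge.
apply: lee_wpmul2l; first by rewrite lee_fin.
by apply: leeD; apply: lee_wpmul2l.
Qed.

End signed_parts.

(** * Sufficiency *)

Section normalized.
Context {R : realType} {T : Type}.
Variable p : R.
Hypothesis p0 : 0 < p.

Definition shifted (X : nat * nat -> T -> R) (c : nat * nat -> R) (w : T)
  (i j : nat) : R := X (i.+1, j.+1) w - c (i.+1, j.+1).

(** Empty rectangles contribute [0] to [rectmax], which is harmless for a
    maximum of absolute values. *)
Lemma normalized_maxE (X : nat * nat -> T -> R) (c : nat * nat -> R) mn w :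
  normalized_max p X c mn w =
  rectmax (shifted X c w) 0 0 mn.1 mn.2 / (mn.1 * mn.2)%:R `^ p^-1.
Proof.
have sumE u v : \sum_(1 <= i < u.+1) \sum_(1 <= j < v.+1) (X (i, j) w - c (i, j)) =
    rsum (shifted X c w) 0 0 u v.
  rewrite big_add1 big_mkord; apply: eq_bigr => i _.
  by rewrite big_add1 big_mkord.
have rowE u : \big[Num.max/0]_(1 <= v < mn.2.+1)
    `|\sum_(1 <= i < u.+1) \sum_(1 <= j < v.+1) (X (i, j) w - c (i, j))| =
    rowmax (shifted X c w) 0 0 u mn.2.
  rewrite big_add1 big_mkord /rowmax big_ord_recl.
  rewrite {1}/rsum big1 ?normr0 => [|i _]; last by rewrite big_ord0.
  rewrite max_r ?bigmax_ge_id//.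
  by apply: eq_bigr => v _; rewrite sumE.
congr (_ / _); rewrite big_add1 big_mkord /rectmax big_ord_recl.
rewrite [X in Num.max X _](_ : _ = 0).
  by rewrite max_r ?bigmax_ge_id//; apply: eq_bigr => u _; rewrite rowE.
apply/eqP; rewrite eq_le rowmax_ge0 andbT; apply: rowmax_le => // v _.
by rewrite /rsum big_ord0 normr0.
Qed.

Lemma normalized_max_ge0 (X : nat * nat -> T -> R) c mn w :
  0 <= normalized_max p X c mn w.
Proof. by rewrite normalized_maxE divr_ge0 ?rectmax_ge0 ?powR_ge0. Qed.

Lemma normalized_max_powR (X : nat * nat -> T -> R) (c : nat * nat -> R) mn w :
  posidx mn ->
  normalized_max p X c mn w `^ p =
  (mn.1 * mn.2)%:R^-1 * rectmax (shifted X c w) 0 0 mn.1 mn.2 `^ p.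
Proof.
move=> [m0 n0]; set D : R := (mn.1 * mn.2)%:R.
have D0 : 0 < D by rewrite ltr0n muln_gt0 m0.
have Dp : (D `^ p^-1) `^ p = D.
  by rewrite -powRrM mulVf ?gt_eqF// powRr1// ltW.
have : (normalized_max p X c mn w * D `^ p^-1) `^ p =
    rectmax (shifted X c w) 0 0 mn.1 mn.2 `^ p.
  by rewrite normalized_maxE divfK// gt_eqF// powR_gt0.
rewrite powRM ?normalized_max_ge0 ?powR_ge0// Dp => <-.
by rewrite mulrC mulfK// gt_eqF.
Qed.

End normalized.

Lemma rectmax_le_dim {R : realType} (z : nat -> nat -> R) a b m n m' n' :
  (m <= m')%N -> (n <= n')%N -> rectmax z a b m n <= rectmax z a b m' n'.
Proof.
move=> mm nn; apply: rectmax_le; first exact: rectmax_ge0.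
by move=> u v um vn; apply: rectmax_ge; [exact: leq_trans mm|exact: leq_trans nn].
Qed.

Lemma rectmaxB {R : realType} (z1 z2 : nat -> nat -> R) a b m n :
  rectmax (fun i j => z1 i j - z2 i j) a b m n <=
  rectmax z1 a b m n + rectmax z2 a b m n.
Proof.
apply: rectmax_le => [|u v um vn]; first by rewrite addr_ge0 ?rectmax_ge0.
by rewrite rsumB (le_trans (ler_normB _ _))// lerD ?rectmax_ge.
Qed.

(** Convergence to [0] of extended nonnegative quantities includes being
    eventually finite. *)
Lemma cvge0_of_le {R : realType} {I : Type} (F : set_system I) {FF : Filter F}
    (u : I -> \bar R) :
  (forall i, 0 <= u i)%E ->
  (forall eps : R, 0 < eps -> \forall i \near F, (u i <= eps%:E)%E) ->
  u i @[i --> F] --> 0%E.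
Proof.
move=> u0 ueps; apply/fine_cvgP; split.
  near=> i; rewrite ge0_fin_numE//; apply: (@le_lt_trans _ _ 1%:E).
    by near: i; exact: ueps.
  by rewrite ltry.
apply/cvgrPdist_le => eps eps0; near=> i.
rewrite sub0r normrN ger0_norm ?fine_ge0//.
have ui : (u i <= eps%:E)%E by near: i; exact: ueps.
rewrite -lee_fin fineK// ge0_fin_numE//; apply: le_lt_trans ui _.
by rewrite ltry.
Unshelve. all: by end_near.
Qed.

Section sufficiency.
Context {R : realType} {d d' : measure_display} {T : measurableType d}
  {T' : measurableType d'} {P : probability T R} {P' : probability T' R}.
Variables (p : R) (X : nat * nat -> {RV P >-> R}) (Y : {RV P' >-> R}).
Hypothesis hp : 1 <= p < 2.
Hypothesis hX : condition_H2 posidx X.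
Hypothesis XY : stochastically_dominated posidx X Y.
Hypothesis Yp : ('E_P'[fun w => (`|Y w| `^ p)%R] < +oo)%E.

Let absY w := `|Y w|.

Let mabsY : measurable_fun setT absY.
Proof. exact: measurableT_comp. Qed.

Let part_dominated sg i j (x : R) : sg = 1 \/ sg = -1 ->
  (P [set w | (x < signed_part X sg i j w)%R] <= P' [set w | (x < absY w)%R])%E.
Proof.
move=> sg1; have [x0|x0] := ltP x 0.
  rewrite (_ : [set w | (x < absY w)%R] = setT) ?probability_setT.
    apply: probability_le1; rewrite -[X in measurable X]setTI.
    by apply: measurable_fun_ltr => //; exact: measurable_part.
  by apply/seteqP; split=> w //= _; exact: lt_le_trans (normr_ge0 _).
apply: le_trans (XY x).
apply: (@le_trans _ _ (P [set w | (x < `|X (i.+1, j.+1) w|)%R])); last first.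
  by apply: ereal_sup_ubound; exists (i.+1, j.+1).
apply: le_measure; rewrite ?inE.
- rewrite -[X in measurable X]setTI.
  by apply: measurable_fun_ltr => //; exact: measurable_part.
- rewrite -[X in measurable X]setTI.
  by apply: measurable_fun_ltr => //; exact: measurableT_comp.
move=> w /=; rewrite /signed_part lt_max [X in _ || X]ltNge x0 orbF.
move=> /lt_le_trans; apply.
by case: sg1 => ->; rewrite ?mul1r ?mulN1r ?ler_norm// -normrN ler_norm.
Qed.

Let absY_mean : exists A : R, ('E_P'[absY] <= A%:E)%E.
Proof.
have YpE : ('E_P'[fun w => (`|Y w| `^ p)%R])%E =
    (fine ('E_P'[fun w => (`|Y w| `^ p)%R])%E)%:E.
  by rewrite fineK// ge0_fin_numE//; apply: expectation_ge0 => w; exact: powR_ge0.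
exists (1 + fine ('E_P'[fun w => (`|Y w| `^ p)%R])%E).
apply: le_trans (_ : ('E_P'[absY] <= 'E_P'[fun w => (1 + `|Y w| `^ p)%R])%E) _.
  apply: expectation_mono => w; first exact: normr_ge0.
  have [y1|/ltW y1] := leP (absY w) 1; first by rewrite ler_wpDr// powR_ge0.
  by rewrite ler_wpDl// le1r_powR//; case/andP: hp.
apply: expectation_add_le => //.
- by apply: (measurableT_comp (f := fun x => x `^ p)).
- by rewrite expectation_const.
- by rewrite -YpE.
Qed.

Let part_mean sg i j : sg = 1 \/ sg = -1 ->
  exists A : R, ('E_P[signed_part X sg i j] <= A%:E)%E.
Proof.
move=> sg1; have [A YA] := absY_mean; exists A; apply: le_trans YA.
have E1 : 'E_P[signed_part X sg i j]%E = 'E_P[fun w => excess 0 (signed_part X sg i j w)]%E.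
  congr expectation; apply/funext => w.
  by rewrite /excess subr0 max_l// part_ge0.
have E2 : 'E_P'[absY]%E = 'E_P'[fun w => excess 0 (absY w)]%E.
  congr expectation; apply/funext => w.
  by rewrite /excess subr0 max_l// normr_ge0.
rewrite E1 E2; apply: (expectation_le_of_tails (X := signed_part X sg i j) (Y := absY)
  (g := excess 0)) => //.
- exact: measurable_part.
- by move=> w; exact: normr_ge0.
- by move=> x; exact: (part_dominated i j x sg1).
- exact: excess_homo.
- exact: excess_continuous.
- by move=> x; exact: excess_ge0.
Qed.

Let XE i j w : X (i.+1, j.+1) w = signed_part X 1 i j w - signed_part X (-1) i j w.
Proof.
rewrite /signed_part mul1r mulN1r /Num.max; case: ifPn; case: ifPn;
  rewrite -?leNgt => *; lra.
Qed.

Let shiftedE w i j :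
  shifted X (fun ij => fine ('E_P[X ij])%E) w i j =
  centered (P := P) (signed_part X 1) id w i j -
  centered (P := P) (signed_part X (-1)) id w i j.
Proof.
have [A1 E1] := part_mean i j (or_introl (erefl (1 : R))).
have [A2 E2] := part_mean i j (or_intror (erefl (-1 : R))).
have i1 := integrable_of_expectation (measurable_part X 1 i j)
  (part_ge0 X 1 i j) E1.
have i2 := integrable_of_expectation (measurable_part X (-1) i j)
  (part_ge0 X (-1) i j) E2.
rewrite /shifted /centered XE.
have -> : ('E_P[X (i.+1, j.+1)] = 'E_P[signed_part X 1 i j] - 'E_P[signed_part X (-1) i j])%E.
  rewrite unlock -integralB_EFin//; apply: eq_integral => w' _.
  by rewrite XE EFinB.
have [_ _ ->] := fine_expectation_bounds (part_ge0 X 1 i j) E1.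
have [_ _ ->] := fine_expectation_bounds (part_ge0 X (-1) i j) E2.
by rewrite /=; ring.
Qed.

Lemma rectmax_shifted_le w m n :
  rectmax (shifted X (fun ij => fine ('E_P[X ij])%E) w) 0 0 m n <=
  rectmax (centered (P := P) (signed_part X 1) id w) 0 0 m n +
  rectmax (centered (P := P) (signed_part X (-1)) id w) 0 0 m n.
Proof.
rewrite (_ : shifted _ _ w = fun i j =>
  centered (P := P) (signed_part X 1) id w i j -
  centered (P := P) (signed_part X (-1)) id w i j); first exact: rectmaxB.
by apply/funext => i; apply/funext => j; exact: shiftedE.
Qed.

Let part_moment sg (eps : R) : sg = 1 \/ sg = -1 -> 0 < eps ->
  \forall s \near \oo, forall j l, (j + l)%N = s ->
  ('E_P[fun w => (rectmax (centered (P := P) (signed_part X sg) id w) 0 0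
      (2 ^ j) (2 ^ l) `^ p)%R] <= (eps * (2 ^ s)%:R)%:E)%E.
Proof.
move=> sg1 eps0; have [K K0 HK] := variance_bound_part sg1 hX.
apply: (@dominated_rectmax_moment _ _ _ _ _ P P' p (signed_part X sg) K absY)
  => //.
- by move=> i j; exact: measurable_part.
- by move=> i j w; exact: part_ge0.
- by move=> w; exact: normr_ge0.
- by move=> i j x; exact: (part_dominated i j x sg1).
Qed.

Lemma leq_two_up_log m : (0 < m)%N -> (2 ^ up_log 2 m <= 2 * m)%N.
Proof.
case: m => [//|[//|m]] _; have := up_log_gtn (p := 2) (n := m.+2) isT isT.
have : (0 < up_log 2 m.+2)%N by rewrite up_log_gt0.
by case: (up_log 2 m.+2) => [//|k] _ /= km; rewrite expnS leq_mul2l ltnW.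
Qed.

(** A rectangle is enlarged to dyadic sides, which multiplies the number of
    cells by at most [4].  Since only the exponent [j + l] of the enlarged area
    matters, it is enough that one of the two sides is large. *)
Theorem sufficiency : cvg_Lp_to0 P maxn_oo p
  (normalized_max p X (fun ij => fine ('E_P[X ij])%E)).
Proof.
have p0 : 0 < p by case/andP: hp; lra.
apply: cvge0_of_le => [mn|eps eps0].
  by apply: expectation_ge0 => w; exact: powR_ge0.
have three0 : 0 < 3 `^ p :> R by rewrite powR_gt0.
(* 2 for the two signed parts, 4 for the enlargement to dyadic sides *)
pose e := eps / (8 * 3 `^ p).
have e0 : 0 < e by rewrite divr_gt0// mulr_gt0.
have [S1 _ HS1] := part_moment (or_introl (erefl (1 : R))) e0.
have [S2 _ HS2] := part_moment (or_intror (erefl (-1 : R))) e0.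
pose S := maxn S1 S2.
exists (2 ^ S)%N => // -[m n] /= [[/= m0 n0] Smn].
pose j := up_log 2 m; pose l := up_log 2 n.
have mj : (m <= 2 ^ j)%N by exact: up_logP.
have nl : (n <= 2 ^ l)%N by exact: up_logP.
have Sjl : (S <= j + l)%N.
  move: Smn; rewrite leq_max => /orP[Sm|Sn].
    apply: leq_trans (leq_addr _ _); rewrite -(@leq_exp2l 2)//.
    exact: leq_trans Sm mj.
  apply: leq_trans (leq_addl _ _); rewrite -(@leq_exp2l 2)//.
  exact: leq_trans Sn nl.
pose s := (j + l)%N.
have s4 : (2 ^ s)%:R <= 4 * (m * n)%:R :> R.
  rewrite -natrM ler_nat expnD (_ : 4 * _ = (2 * m) * (2 * n))%N.
    by apply: leq_mul; exact: leq_two_up_log.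
  by rewrite mulnACA.
pose V sg w := rectmax (centered (P := P) (signed_part X sg) id w) 0 0 (2 ^ j) (2 ^ l).
have mV sg : measurable_fun setT (fun w => V sg w `^ p).
  apply: (measurableT_comp (f := fun x => x `^ p)) => //.
  apply: measurable_rectmax => i k; apply: measurable_centered => //.
  by move=> i' k'; exact: measurable_part.
have E1 : ('E_P[fun w => (V 1 w `^ p)%R] <= (e * (2 ^ s)%:R)%:E)%E.
  apply: (HS1 s) => //=; apply: leq_trans Sjl; exact: leq_maxl.
have E2 : ('E_P[fun w => (V (-1)%R w `^ p)%R] <= (e * (2 ^ s)%:R)%:E)%E.
  apply: (HS2 s) => //=; apply: leq_trans Sjl; exact: leq_maxr.
have D0 : 0 < (m * n)%:R :> R by rewrite ltr0n muln_gt0 m0.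
have cst0 : 0 <= (m * n)%:R^-1 * 3 `^ p :> R.
  by rewrite mulr_ge0 ?invr_ge0// ltW.
apply: (@le_trans _ _ ((m * n)%:R^-1 * 3 `^ p * (e * (2 ^ s)%:R) +
    (m * n)%:R^-1 * 3 `^ p * (e * (2 ^ s)%:R))%:E).
  apply: (expectation_comb (g := fun w => V 1 w `^ p)
    (h := fun w => V (-1) w `^ p)) => //.
  - by move=> w; exact: powR_ge0.
  - by move=> w; exact: powR_ge0.
  move=> w; rewrite ger0_norm ?normalized_max_ge0//.
  rewrite normalized_max_powR//= -!mulrA -mulrDr ler_wpM2l ?invr_ge0//.
  rewrite -mulrDr.
  have V1 : 0 <= V 1 w by exact: rectmax_ge0.
  have V2 : 0 <= V (-1) w by exact: rectmax_ge0.
  apply: le_trans (_ : _ <= 3 `^ p * (V 1 w `^ p + V (-1) w `^ p + 0 `^ p)) _;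
    last by rewrite (powR0 (lt0r_neq0 p0)) addr0.
  apply: le_trans (powR_add3 hp V1 V2 (lexx 0)).
  rewrite addr0; apply: powR_homo; [exact: ltW|exact: rectmax_ge0|].
  apply: le_trans (rectmax_le_dim _ _ _ mj nl) _.
  exact: rectmax_shifted_le.
rewrite lee_fin -mulrDr -mulrDl -mulrA -[leRHS](mulKf (lt0r_neq0 D0)).
rewrite ler_wpM2l ?invr_ge0//.
have -> : 3 `^ p * ((e + e) * (2 ^ s)%:R) = eps / 4 * (2 ^ s)%:R.
  by rewrite /e; field; rewrite gt_eqF.
apply: le_trans (ler_wpM2l _ s4) _; first by rewrite divr_ge0// ltW.
by rewrite le_eqVlt; apply/orP; left; apply/eqP; field.
Qed.

End sufficiency.

(** * Necessity *)

Section equal_laws.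
Context {R : realType} {d d' : measure_display} {T : measurableType d}
  {T' : measurableType d'} {P : probability T R} {P' : probability T' R}.
Variables (X : {RV P >-> R}) (Y : {RV P' >-> R}).
Hypothesis XY : cdf X = cdf Y.

(** Open half-lines generate the Borel sets and are stable under
    intersection. *)
Lemma distribution_eq (A : set R) : measurable A ->
  distribution P X A = distribution P' Y A.
Proof.
move: A; apply: (measure_unique (@RGenOInfty.G R) (fun k => `]- k%:R, +oo[%classic)).
- exact: RGenOInfty.measurableE.
- move=> _ _ [x ->] [y ->]; exists (Num.max x y).
  apply/seteqP; split=> z /=; rewrite !in_itv/= !andbT gt_max.
    by move=> [-> ->].
  by move=> /andP[].
- by move=> k; exists (- k%:R).
- apply/seteqP; split=> x //= _; exists (Num.truncn (- x)).+1 => //=.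
  by rewrite in_itv/= andbT ltrNl truncnS_gt.
- move=> _ [x ->].
  have EX := cdf_ccdf_1 X x; have EY := cdf_ccdf_1 Y x.
  have fX : cdf X x \is a fin_num by exact: fin_num_measure.
  transitivity (1 - cdf X x)%E.
    by rewrite -EX addrAC subee// add0e.
  by rewrite [in LHS]XY -EY addrAC subee ?add0e// -XY.
- by move=> k; apply: le_lt_trans (probability_le1 _ _) _ => //; rewrite ltry.
Qed.

Lemma expectation_eq_law (g : R -> R) :
  measurable_fun setT g -> (forall x, 0 <= g x) ->
  'E_P[fun w => g (X w)]%E = 'E_P'[fun w => g (Y w)]%E.
Proof.
move=> mg g0; rewrite unlock.
have mgE : measurable_fun setT (fun x => (g x)%:E) by exact/measurable_EFinP.
have g0E x : (0 <= (g x)%:E)%E by rewrite lee_fin.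
rewrite -(ge0_integral_distribution X mgE g0E).
rewrite -(ge0_integral_distribution Y mgE g0E).
by apply: eq_measure_integral => A mA _; exact: distribution_eq.
Qed.

Lemma mean_eq_law : P.-integrable setT (EFin \o X) ->
  P'.-integrable setT (EFin \o Y) -> ('E_P[X] = 'E_P'[Y])%E.
Proof.
move=> iX iY; rewrite unlock.
have mid : measurable_fun setT (@EFin R) by exact: EFin_measurable.
rewrite -(integral_distribution mid iX) -(integral_distribution mid iY).
by apply: eq_measure_integral => A mA _; exact: distribution_eq.
Qed.

End equal_laws.

Section necessity.
Context {R : realType} {d d' : measure_display} {T : measurableType d}
  {T' : measurableType d'} {P : probability T R} {P' : probability T' R}.
Variables (p : R) (X : nat * nat -> {RV P >-> R}) (Y : {RV P' >-> R}) (mu : R).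
Hypothesis hp : 1 <= p < 2.
Hypothesis XY : forall ij, posidx ij -> cdf (X ij) = cdf Y.
Hypothesis X_cvg : cvg_Lp_to0 P maxn_oo p (normalized_max p X (fun=> mu)).

Let p0 : 0 < p. Proof. by case/andP: hp; lra. Qed.

Let measurable_powR_norm (d1 : measure_display) (T1 : measurableType d1)
  (f : T1 -> R) : measurable_fun setT f ->
  measurable_fun setT (fun w => `|f w| `^ p).
Proof.
move=> mf; apply: (measurableT_comp (f := fun x => x `^ p)) => //.
exact: measurableT_comp.
Qed.

Let Lp_small (c : nat * nat -> R) (eps : R) : 0 < eps ->
  cvg_Lp_to0 P maxn_oo p (normalized_max p X c) ->
  maxn_oo [set mn | ('E_P[fun w => (`|normalized_max p X c mn w| `^ p)%R]
    <= eps%:E)%E].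
Proof.
move=> eps0 /fine_cvgP[fin_cvg /cvgrPdist_le /(_ _ eps0) le_eps].
apply: filterS2 fin_cvg le_eps => mn /= finE.
rewrite sub0r normrN => /(le_trans (ler_norm _)).
by rewrite -lee_fin fineK.
Qed.

Let measurable_shifted c i j :
  measurable_fun setT (fun w => shifted X c w i j).
Proof. by apply: measurable_funB => //; exact: measurable_cst. Qed.

Let measurable_normalized c mn :
  measurable_fun setT (normalized_max p X c mn).
Proof.
rewrite (_ : normalized_max p X c mn = fun w =>
    rectmax (shifted X c w) 0 0 mn.1 mn.2 * ((mn.1 * mn.2)%:R `^ p^-1)^-1);
  last by apply/funext => w; exact: normalized_maxE.
apply: measurable_funM; last exact: measurable_cst.
by apply: measurable_rectmax => i j; exact: measurable_shifted.
Qed.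

(** The subrectangle reduced to the first cell is among those of the maximum,
    so one finite moment of a normalized maximum bounds that of [X (1, 1)]. *)
Lemma law_moment : ('E_P'[fun w => (`|Y w| `^ p)%R] < +oo)%E.
Proof.
have pos11 : posidx (1%N, 1%N) by [].
have mg : measurable_fun setT (fun x : R => `|x| `^ p).
  by apply: measurable_powR_norm.
rewrite -(expectation_eq_law (XY pos11) mg) => [|x]; last exact: powR_ge0.
have E1 := Lp_small ltr01 X_cvg.
have [mn [mn0 /= {}E1]] : exists mn, posidx mn /\
    ('E_P[fun w => (`|normalized_max p X (fun=> mu) mn w| `^ p)%R] <= 1%:E)%E.
  have : maxn_oo posidx by exists 0%N => // mn [].
  by move=> /(filterI E1) /filter_ex[mn [? ?]]; exists mn.
have D0 : 0 < (mn.1 * mn.2)%:R :> R by case: mn0 => ? ?; rewrite ltr0n muln_gt0; apply/andP.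
apply: (@le_lt_trans _ _ (3 `^ p * (mn.1 * mn.2)%:R * 1 +
    3 `^ p * `|mu| `^ p)%:E); last by rewrite ltry.
apply: (expectation_comb
  (g := fun w => `|normalized_max p X (fun=> mu) mn w| `^ p)
  (h := fun=> `|mu| `^ p)) => //.
- exact: measurable_powR_norm.
- move=> w; rewrite (ger0_norm (normalized_max_ge0 _ _ _ _ _)).
  rewrite normalized_max_powR// -!mulrA mulVKf ?gt_eqF// -mulrDr.
  set M := rectmax _ _ _ _ _.
  have M0 : 0 <= M by exact: rectmax_ge0.
  have XM : `|X (1%N, 1%N) w - mu| <= M.
    have [m0 n0] := mn0.
    have := @rectmax_ge _ (shifted X (fun=> mu) w) 0 0 mn.1 mn.2 1 1 m0 n0.
    by rewrite /rsum !big_ord1.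
  apply: le_trans (_ : _ <= 3 `^ p * (M `^ p + `|mu| `^ p + 0 `^ p)) _;
    last by rewrite (powR0 (lt0r_neq0 p0)) addr0.
  apply: le_trans (powR_add3 hp M0 (normr_ge0 mu) (lexx 0)).
  rewrite addr0; apply: powR_homo => //; first exact: ltW.
  rewrite -[X in `|X|](subrK mu); apply: le_trans (ler_normD _ _) _.
  by rewrite lerD2r.
- by rewrite expectation_const.
Qed.

Lemma law_dominated : stochastically_dominated posidx X Y.
Proof.
move=> x; apply: ge_ereal_sup => _ [ij pos <-].
have mA : measurable [set y : R | x < `|y|].
  rewrite -[X in measurable X]setTI; apply: measurable_fun_ltr => //.
by have := distribution_eq (XY pos) mA; rewrite /distribution /pushforward /= => ->.
Qed.

Let integrable_RV (d1 : measure_display) (T1 : measurableType d1)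
  (Q : probability T1 R) (W : {RV Q >-> R}) :
  ('E_Q[fun w => (`|W w| `^ p)%R] < +oo)%E -> Q.-integrable setT (EFin \o W).
Proof.
move=> Wp; have WpE : ('E_Q[fun w => (`|W w| `^ p)%R])%E =
    (fine ('E_Q[fun w => (`|W w| `^ p)%R])%E)%:E.
  by rewrite fineK// ge0_fin_numE//; apply: expectation_ge0 => w; exact: powR_ge0.
have i1 : Q.-integrable setT (EFin \o (fun w => 1 + `|W w| `^ p)).
  apply: (integrable_of_expectation
    (A := 1 + fine ('E_Q[fun w => (`|W w| `^ p)%R])%E)).
  - by apply: measurable_funD => //; exact: measurable_powR_norm.
  - by move=> w; rewrite addr_ge0// powR_ge0.
  - apply: expectation_add_le => //.
    + exact: measurable_powR_norm.
    + by rewrite expectation_const.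
    + by rewrite -WpE.
apply: le_integrable i1 => //; first exact/measurable_EFinP.
move=> w _; rewrite /= lee_fin [leRHS]ger0_norm; last first.
  by rewrite addr_ge0// powR_ge0.
have [y1|/ltW y1] := leP `|W w| 1; first by rewrite ler_wpDr// powR_ge0.
by rewrite ler_wpDl// le1r_powR//; case/andP: hp.
Qed.

(** On the full rectangle the sums for the two centrings differ by
    [mn |mu - E Y|], at least [|mu - E Y|] after normalization since
    [p >= 1]; this constant is thus bounded by two vanishing quantities. *)
Lemma law_mean : condition_H2 posidx X -> ('E_P'[Y] = mu%:E)%E.
Proof.
move=> hX; pose m0 := fine 'E_P'[Y]%E.
have iY := integrable_RV law_moment.
have EYfin : ('E_P'[Y])%E \is a fin_num.
  by rewrite unlock; exact: integrable_fin_num.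
have meanX ij : posidx ij -> fine ('E_P[X ij])%E = m0.
  move=> pos; rewrite (mean_eq_law (XY pos))//; apply: integrable_RV.
  have mg : measurable_fun setT (fun x : R => `|x| `^ p).
    by apply: measurable_powR_norm.
  rewrite (expectation_eq_law (XY pos) mg) => [|x]; last exact: powR_ge0.
  exact: law_moment.
have X_cvg' := sufficiency hp hX law_dominated law_moment.
suff m0mu : m0 = mu by rewrite -m0mu /m0 fineK.
apply/eqP; rewrite -subr_eq0 -normr_eq0; apply/eqP.
apply: (@powR_eq0_eq0 _ _ p); apply/eqP; rewrite eq_le powR_ge0 andbT.
apply/ler_addgt0Pl => eps eps0; rewrite addr0.
have three0 : 0 < 3 `^ p :> R by rewrite powR_gt0.
pose e := eps / (2 * 3 `^ p).
have e0 : 0 < e by rewrite divr_gt0// mulr_gt0.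
have E1 := Lp_small e0 X_cvg; have E2 := Lp_small e0 X_cvg'.
have [mn [mn0 /= {}E1 {}E2]] : exists mn, [/\ posidx mn,
    ('E_P[fun w => (`|normalized_max p X (fun=> mu) mn w| `^ p)%R] <= e%:E)%E &
    ('E_P[fun w => (`|normalized_max p X (fun ij => fine ('E_P[X ij])%E) mn w|
      `^ p)%R] <= e%:E)%E].
  have : maxn_oo posidx by exists 0%N => // mn [].
  by move=> /(filterI (filterI E1 E2)) /filter_ex[mn [[? ?] ?]]; exists mn.
have -> : eps = 3 `^ p * e + 3 `^ p * e by rewrite /e; field; rewrite gt_eqF.
rewrite -lee_fin -(expectation_const (P := P)).
apply: (expectation_comb
  (g := fun w => `|normalized_max p X (fun=> mu) mn w| `^ p)
  (h := fun w => `|normalized_max p X (fun ij => fine ('E_P[X ij])%E) mn w| `^ p))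
  => //.
- exact: measurable_powR_norm.
- exact: measurable_powR_norm.
move=> w; rewrite !(ger0_norm (normalized_max_ge0 _ _ _ _ _)) -mulrDr.
set N1 := normalized_max _ _ _ _ _; set N2 := normalized_max _ _ _ _ _.
have N10 : 0 <= N1 by exact: normalized_max_ge0.
have N20 : 0 <= N2 by exact: normalized_max_ge0.
apply: le_trans (_ : _ <= 3 `^ p * (N1 `^ p + N2 `^ p + 0 `^ p)) _;
  last by rewrite (powR0 (lt0r_neq0 p0)) addr0.
apply: le_trans (powR_add3 hp N10 N20 (lexx 0)).
rewrite addr0; apply: powR_homo => //; first exact: ltW.
have [mn1 mn2] := mn0.
have D1 : 1 <= (mn.1 * mn.2)%:R :> R by rewrite ler1n muln_gt0 mn1.
set D := (mn.1 * mn.2)%:R in D1.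
have D0 : 0 < D by exact: lt_le_trans D1.
rewrite /N1 /N2 !normalized_maxE -mulrDl ler_pdivlMr ?powR_gt0//.
apply: (@le_trans _ _ (`|m0 - mu| * D)).
  rewrite ler_wpM2l// -[leRHS]powRr1; last exact: ltW.
  by apply: ler_powR => //; rewrite invf_le1//; case/andP: hp.
rewrite -[D]ger0_norm ?(ltW D0)// -normrM.
have -> : (m0 - mu) * D = rsum (shifted X (fun=> mu) w) 0 0 mn.1 mn.2 -
    rsum (shifted X (fun ij => fine ('E_P[X ij])%E) w) 0 0 mn.1 mn.2.
  rewrite -rsumB mulrC -(rsum_cst (m0 - mu) 0 0 mn.1 mn.2).
  apply: eq_bigr => i _; apply: eq_bigr => j _.
  by rewrite /shifted meanX//; ring.
by apply: le_trans (ler_normB _ _) _; rewrite lerD ?rectmax_ge.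
Qed.

End necessity.

Theorem theorem1p6 (R : realType) (d : measure_display) (T : measurableType d)
    (P : probability T R) (p : R) (hp : 1 <= p < 2)
    (X : nat * nat -> {RV P >-> R}) (hX : condition_H2 posidx X) :
  (forall (d' : measure_display) (T' : measurableType d')
          (P' : probability T' R) (Y : {RV P' >-> R}),
      stochastically_dominated posidx X Y ->
      ('E_P'[fun w => (`|Y w| `^ p)%R] < +oo)%E ->
      cvg_Lp_to0 P maxn_oo p
        (normalized_max p X (fun ij => fine ('E_P[X ij])%E)))
  /\
  (forall (d' : measure_display) (T' : measurableType d')
          (P' : probability T' R) (Y : {RV P' >-> R}) (mu : R),
      (forall ij, posidx ij -> cdf (X ij) = cdf Y) ->
      cvg_Lp_to0 P maxn_oo p (normalized_max p X (fun=> mu)) ->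
      ('E_P'[Y] = mu%:E)%E /\ ('E_P'[fun w => (`|Y w| `^ p)%R] < +oo)%E).
Proof.
split=> [d' T' P' Y XY Yp|d' T' P' Y mu XY X_cvg].
  exact: sufficiency.
by split; [exact: (law_mean hp XY X_cvg hX)|exact: (law_moment hp XY X_cvg)].
Qed.
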